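(* Let $d,n_S,n_U\ge1$, $\sigma>0$, $r>0$, $\rho>0$, $\delta\in(0,1)$. Let $p_S,p_T$ be mean-zero $\rho^2$-subgaussian distributions on $\mathbb{R}^d$ with second-moment matrices $\Sigma_S=\mathbb{E}_{p_S}[\mathbf{x}\mathbf{x}^\top]$ (invertible) and $\Sigma_T=\mathbb{E}_{p_T}[\mathbf{x}\mathbf{x}^\top]$. Let $X_S\in\mathbb{R}^{n_S\times d}$ have i.i.d. rows from $p_S$ and $X_U\in\mathbb{R}^{n_U\times d}$ i.i.d. rows from $p_T$, independent; put $\hat\Sigma_S=X_S^\top X_S/n_S$, $\hat\Sigma_U=X_U^\top X_U/n_U$. Observations are $\mathbf{y}_S=X_S\boldsymbol{\beta}^*+\mathbf{z}$, $\mathbf{z}\sim\mathcal{N}(0,\sigma^2I_{n_S})$, $\boldsymbol{\beta}^*\in\mathcal{B}:=\{\boldsymbol{\beta}:\|\boldsymbol{\beta}\|_2\le r\}$. Let $\hat C$ be the $C$-component of an optimal solution of $$\min_{C,\tau}\ r^2\tau+\frac{\sigma^2}{n_S}\operatorname{Tr}(C\hat\Sigma_S^{-1}C^\top\hat\Sigma_U)\quad\text{s.t.}\quad (C-I)^\top\hat\Sigma_U(C-I)\preceq\tau I,$$ and $\hat{\boldsymbol{\beta}}(\mathbf{y}_S):=\hat C\hat\Sigma_S^{-1}X_S^\top\mathbf{y}_S/n_S$. Define $L_{\mathcal{B}}(\hat{\boldsymbol{\beta}}):=\max_{\boldsymbol{\beta}^*\in\mathcal{B}}\mathbb{E}_{\mathbf{z}}\mathbb{E}_{\mathbf{x}\sim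 p_T}(\mathbf{x}^\top(\hat{\boldsymbol{\beta}}(\mathbf{y}_S)-\boldsymbol{\beta}^* ))^2$ (with $X_S$ held fixed). Further let $\mathbf{y}_R:=\Sigma_S^{1/2}\boldsymbol{\beta}^*+\mathbf{z}_R$ with $\mathbf{z}_R\sim\mathcal{N}(0,\frac{\sigma^2}{n_S}I_d)$, and for an estimator $\boldsymbol{\beta}:\mathbb{R}^d\to\mathbb{R}^d$ define $L_{R,\mathcal{B}}(\boldsymbol{\beta}):=\max_{\boldsymbol{\beta}^*\in\mathcal{B}}\mathbb{E}_{\mathbf{z}_R}\mathbb{E}_{\mathbf{x}\sim p_T}(\mathbf{x}^\top(\boldsymbol{\beta}(\mathbf{y}_R)-\boldsymbol{\beta}^* ))^2$. Suppose $n_S,n_U\ge c_0\rho^4(d+\log(1/\delta))$ for a sufficiently large absolute constant $c_0$. Then with probability at least $1-\delta$ over $X_S$ and $X_U$, $$L_{\mathcal{B}}(\hat{\boldsymbol{\beta}})\le\Big(1+O\Big(\sqrt{\tfrac{\rho^4(d+\log(1/\delta))}{n_U}}\Big)+O\Big(\sqrt{\tfrac{\rho^4(d+\log(1/\delta))}{n_S}}\Big)\Big)\min_{A\in\mathbb{R}^{d\times d}}L_{R,\mathcal{B}}(\mathbf{y}_R\mapsto A\mathbf{y}_R),$$ where $O(\cdot)$ hides absolute constants.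
   Context: A mean-zero distribution $p$ on $\mathbb{R}^d$ with second-moment matrix $\Sigma$ is $\rho^2$-subgaussian if the whitened vector $\bar{\mathbf{x}}=\Sigma^{-1/2}\mathbf{x}$ ($\mathbf{x}\sim p$) satisfies $\mathbb{E}[e^{s\,\mathbf{v}^\top(\bar{\mathbf{x}}-\mathbb{E}\bar{\mathbf{x}})}]\le e^{s^2\rho^2/2}$ for all unit vectors $\mathbf{v}$ and all $s\in\mathbb{R}$. The linear estimators in $\mathbf{y}_R$ may depend on $\Sigma_S,\Sigma_T$ (an oracle with access to the population source covariance). *)

(* Defs.v *)
From HB Require Import structures.
From mathcomp Require Import all_boot all_order all_algebra.
From mathcomp Require Import all_classical all_reals all_analysis.
Set Implicit Arguments. Unset Strict Implicit. Unset Printing Implicit Defensive.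
Import Order.TTheory GRing.Theory Num.Theory.
Local Open Scope classical_set_scope.
Local Open Scope ring_scope.

Section defs.
Context {R : realType}.

Definition vec {d : nat} (x : d.-tuple R) : 'cV[R]_d := \col_i tnth x i.

Fixpoint iter_int {dm} {T : measurableType dm} (mu : {measure set T -> \bar R})
    (n : nat) : (n.-tuple T -> \bar R) -> \bar R :=
  match n with
  | 0 => fun f => f [tuple]
  | n'.+1 => fun f => (\int[mu]_x iter_int mu (fun t : n'.-tuple T => f (cons_tuple x t)))%E
  end.

Definition data_mx {n d : nat} (X : n.-tuple (d.-tuple R)) : 'M[R]_(n, d) :=
  \matrix_(i, j) tnth (tnth X i) j.

Definition sample_cov {n d : nat} (X : n.-tuple (d.-tuple R)) : 'M[R]_d :=
  (n%:R)^-1 *: ((data_mx X)^T *m data_mx X).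

Definition qform {d : nat} (A : 'M[R]_d) (u : 'cV[R]_d) : R := (u^T *m A *m u) ord0 ord0.

Definition loewner_le {d : nat} (A B : 'M[R]_d) : Prop :=
  forall u : 'cV[R]_d, qform A u <= qform B u.

Definition psd {d : nat} (A : 'M[R]_d) : Prop := A^T = A /\ forall u, 0 <= qform A u.

Definition psd_sqrt {d : nat} (A : 'M[R]_d) : 'M[R]_d :=
  xget 0 [set M | psd M /\ M *m M = A].

Definition mp_pinv {d : nat} (A : 'M[R]_d) : 'M[R]_d :=
  xget 0 [set B | A *m B *m A = A /\ B *m A *m B = B /\
                  (A *m B)^T = A *m B /\ (B *m A)^T = B *m A].

Definition second_moment {d : nat} (p : probability (d.-tuple R) R) : 'M[R]_d :=
  \matrix_(i, j) fine (\int[p]_x (tnth x i * tnth x j)%:E)%E.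

Definition has_second_moments {d : nat} (p : probability (d.-tuple R) R) : Prop :=
  forall i j, p.-integrable setT (fun x => (tnth x i * tnth x j)%:E).

Definition mean_zero {d : nat} (p : probability (d.-tuple R) R) : Prop :=
  forall i, (\int[p]_x (tnth x i)%:E = 0)%E.

Definition subgaussian {d : nat} (p : probability (d.-tuple R) R) (rho : R) : Prop :=
  let W := mp_pinv (psd_sqrt (second_moment p)) in
  let m := \col_i fine (\int[p]_x ((W *m vec x) i ord0)%:E)%E in
  forall v : 'cV[R]_d, \sum_i v i ord0 ^+ 2 = 1 -> forall s : R,
    (\int[p]_x (expR (s * (v^T *m (W *m vec x - m)) ord0 ord0))%:E
      <= (expR (s ^+ 2 * rho ^+ 2 / 2))%:E)%E.

End defs.

Section problem.
Context {R : realType}.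
Local Open Scope classical_set_scope.
Local Open Scope ring_scope.

(** probability of an event under the product law p_S^{(x)nS} (x) p_T^{(x)nU},
    computed as an iterated integral (Tonelli) of the indicator *)
Definition sample_prob {d nS nU : nat} (pS pT : probability (d.-tuple R) R)
    (E : set (nS.-tuple (d.-tuple R) * nU.-tuple (d.-tuple R))) : \bar R :=
  iter_int pS (fun XS => iter_int pT (fun XU => (\1_E (XS, XU) : R)%:E)).

Definition ball2 {d : nat} (r : R) : set 'cV[R]_d :=
  [set b | \sum_i b i ord0 ^+ 2 <= r ^+ 2].

Definition prog_obj {d nS : nat} (r sigma : R) (SS SU : 'M[R]_d) (C : 'M[R]_d) (tau : R) : R :=
  r ^+ 2 * tau + sigma ^+ 2 / nS%:R * \tr (C *m invmx SS *m C^T *m SU).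

Definition prog_feas {d : nat} (SU : 'M[R]_d) (C : 'M[R]_d) (tau : R) : Prop :=
  loewner_le ((C - 1)^T *m SU *m (C - 1)) (tau%:M).

Definition prog_opt {d nS : nat} (r sigma : R) (SS SU : 'M[R]_d) (C : 'M[R]_d) (tau : R) : Prop :=
  prog_feas SU C tau /\
  forall C' tau', prog_feas SU C' tau' ->
    @prog_obj d nS r sigma SS SU C tau <= @prog_obj d nS r sigma SS SU C' tau'.

Definition beta_hat {d nS : nat} (XS : nS.-tuple (d.-tuple R)) (C : 'M[R]_d)
    (y : 'cV[R]_nS) : 'cV[R]_d :=
  (nS%:R)^-1 *: (C *m invmx (sample_cov XS) *m (data_mx XS)^T *m y).

Definition loss_S {d nS : nat} (pT : probability (d.-tuple R) R) (sigma r : R)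
    (XS : nS.-tuple (d.-tuple R)) (C : 'M[R]_d) : \bar R :=
  ereal_sup [set iter_int (normal_prob 0 sigma)
      (fun z : nS.-tuple R => \int[pT]_x
         (((vec x)^T *m (beta_hat XS C (data_mx XS *m b + vec z) - b)) ord0 ord0 ^+ 2)%:E)%E
    | b in ball2 r].

Definition loss_R {d : nat} (nS : nat) (pS pT : probability (d.-tuple R) R) (sigma r : R)
    (A : 'M[R]_d) : \bar R :=
  ereal_sup [set iter_int (normal_prob 0 (sigma / Num.sqrt nS%:R))
      (fun z : d.-tuple R => \int[pT]_x
         (((vec x)^T *m (A *m (psd_sqrt (second_moment pS) *m b + vec z) - b)) ord0 ord0 ^+ 2)%:E)%E
    | b in ball2 r].

End problem.

(* Main.v *)
Require Import Defs.
From HB Require Import structures.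
From mathcomp Require Import all_boot all_order all_algebra.
From mathcomp Require Import all_classical all_reals all_analysis.
From mathcomp Require Import measurable_realfun complex spectral sesquilinear mxred.
From mathcomp Require Import ring lra zify.
Import Order.TTheory GRing.Theory Num.Theory.
Local Open Scope classical_set_scope.
Local Open Scope ring_scope.
Set Implicit Arguments.
Unset Strict Implicit.
Unset Printing Implicit Defensive.

(** Write [S_S], [S_T] for the population second moments and [H_S], [H_U] for the
    empirical ones.  With probability at least [1 - delta], uniformly in [u],
    [|u^T (H_S - S_S) u| <= a u^T S_S u] and [|u^T (H_U - S_T) u| <= b u^T S_T u],
    where [a] and [b] are of order [sqrt (rho^4 (d + log (1/delta)) / n)].
    On this event the bias-variance decomposition of the Gaussian losses gives,
    for every matrix [A] and [C' = A S_S^(1/2)],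
      [loss_S Chat <= obj Chat / (1 - b) <= obj C' / (1 - b)
                   <= (1 + b) / ((1 - b) (1 - a)) loss_R A].
    The first step compares [S_T] with [H_U]; the second is optimality of [Chat];
    the third uses [H_U <= (1 + b) S_T], [H_S^-1 <= S_S^-1 / (1 - a)] and
    [C' S_S^-1 C'^T = A A^T].
    The covariance estimate is a Chernoff bound for the squares of the whitened
    linear forms, whose exponential moments come from Gaussian linearization, and
    a union bound over a grid net of the ball.  When [S_T] is singular the samples
    almost surely lie in its range, so whitening by the pseudo-inverse is lossless. *)

(** * Quadratic forms and the Loewner order *)

Section qform_theory.
Context {R : realType}.

Lemma qformD (d : nat) (A B : 'M[R]_d) u : qform (A + B) u = qform A u + qform B u.
Proof. by rewrite /qform mulmxDr mulmxDl mxE. Qed.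

Lemma qformZ (d : nat) a (A : 'M[R]_d) u : qform (a *: A) u = a * qform A u.
Proof. by rewrite /qform -scalemxAr -scalemxAl mxE. Qed.

Lemma qformN (d : nat) (A : 'M[R]_d) u : qform (- A) u = - qform A u.
Proof. by rewrite -scaleN1r qformZ mulN1r. Qed.

Lemma qformB (d : nat) (A B : 'M[R]_d) u : qform (A - B) u = qform A u - qform B u.
Proof. by rewrite qformD qformN. Qed.

Lemma qform_mulmx (d k : nat) (A : 'M[R]_d) (B : 'M[R]_(d, k)) u :
  qform A (B *m u) = qform (B^T *m A *m B) u.
Proof. by rewrite /qform trmx_mul !mulmxA. Qed.

Lemma qform_conj (d k : nat) (A : 'M[R]_d) (B : 'M[R]_(k, d)) u :
  qform (B *m A *m B^T) u = qform A (B^T *m u).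
Proof. by rewrite qform_mulmx trmxK. Qed.

Lemma qform_scalev (d : nat) (A : 'M[R]_d) a (u : 'cV[R]_d) : qform A (a *: u) = a ^+ 2 * qform A u.
Proof.
by rewrite /qform [(_ *: u)^T]linearZ/= -!scalemxAl -scalemxAr scalerA mxE expr2.
Qed.

Lemma qform_gram (n d : nat) (X : 'M[R]_(n, d)) u :
  qform (X^T *m X) u = \sum_i (X *m u) i ord0 ^+ 2.
Proof.
rewrite /qform !mulmxA -mulmxA -trmx_mul mxE.
by apply: eq_bigr => i _; rewrite mxE expr2.
Qed.

Lemma qform_gram_ge0 (n d : nat) (X : 'M[R]_(n, d)) u : 0 <= qform (X^T *m X) u.
Proof. by rewrite qform_gram; apply: sumr_ge0 => i _; rewrite sqr_ge0. Qed.

Lemma qform1 (d : nat) (u : 'cV[R]_d) : qform 1%:M u = \sum_i u i ord0 ^+ 2.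
Proof. by rewrite -[1%:M]mulmx1 -{1}trmx1 qform_gram mul1mx. Qed.

Lemma qform1_ge0 (d : nat) (u : 'cV[R]_d) : 0 <= qform 1%:M u.
Proof. by rewrite qform1; apply: sumr_ge0 => i _; rewrite sqr_ge0. Qed.

Lemma qform1_eq0 (d : nat) (u : 'cV[R]_d) : qform 1%:M u = 0 -> u = 0.
Proof.
rewrite qform1 => /eqP; rewrite psumr_eq0; last by move=> i _; rewrite sqr_ge0.
move=> /allP h; apply/colP => i; rewrite mxE.
by have := h i (mem_index_enum i); rewrite /= sqrf_eq0 => /eqP.
Qed.

Lemma qform1_gt0 (d : nat) (u : 'cV[R]_d) : u != 0 -> 0 < qform 1%:M u.
Proof.
move=> u0; rewrite lt_def qform1_ge0 andbT.
by apply: contra_neq u0; exact: qform1_eq0.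
Qed.

Lemma qform_scalar (d : nat) a (u : 'cV[R]_d) : qform a%:M u = a * qform 1%:M u.
Proof. by rewrite -qformZ scalemx1. Qed.

Lemma qform_expand (d : nat) (A : 'M[R]_d) u :
  qform A u = \sum_i \sum_j A i j * (u i ord0 * u j ord0).
Proof.
rewrite /qform mxE exchange_big/=; apply: eq_bigr => j _.
by rewrite mxE big_distrl/=; apply: eq_bigr => i _; rewrite mxE; ring.
Qed.

Definition bform (d : nat) (A : 'M[R]_d) (u v : 'cV[R]_d) : R :=
  (u^T *m A *m v) ord0 ord0.

Lemma bformDl (d : nat) (A : 'M[R]_d) u u' v :
  bform A (u + u') v = bform A u v + bform A u' v.
Proof. by rewrite /bform [(_ + _)^T]linearD/= !mulmxDl mxE. Qed.

Lemma bformZl (d : nat) (A : 'M[R]_d) a u v : bform A (a *: u) v = a * bform A u v.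
Proof. by rewrite /bform [(_ *: _)^T]linearZ/= -!scalemxAl mxE. Qed.

Lemma bformC (d : nat) (A : 'M[R]_d) u v : A^T = A -> bform A u v = bform A v u.
Proof.
move=> sA; transitivity (((u^T *m A *m v)^T) ord0 ord0); first by rewrite [RHS]mxE.
by rewrite !trmx_mul trmxK sA mulmxA.
Qed.

Lemma qformDv (d : nat) (A : 'M[R]_d) (u v : 'cV[R]_d) : A^T = A ->
  qform A (u + v) = qform A u + 2 * bform A u v + qform A v.
Proof.
move=> sA; have qE w : qform A w = bform A w w by [].
rewrite !qE bformDl !(bformC _ (u + v))// !bformDl (bformC v u)//; ring.
Qed.

Lemma qformBv (d : nat) (A : 'M[R]_d) (u v : 'cV[R]_d) : A^T = A ->
  qform A (u - v) = qform A u - 2 * bform A u v + qform A v.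
Proof.
move=> sA; rewrite qformDv// -[- v]scaleN1r qform_scalev bformC// bformZl.
by rewrite (bformC v u)//; ring.
Qed.

Lemma trmx_sample_cov (n d : nat) (X : n.-tuple (d.-tuple R)) :
  (sample_cov X)^T = sample_cov X.
Proof. by rewrite /sample_cov linearZ/= trmx_mul trmxK. Qed.

Lemma qform_sample_cov (n d : nat) (X : n.-tuple (d.-tuple R)) u :
  qform (sample_cov X) u =
  n%:R^-1 * \sum_(i < n) (u^T *m vec (tnth X i)) ord0 ord0 ^+ 2.
Proof.
rewrite /sample_cov qformZ qform_gram; congr (_ * _); apply: eq_bigr => i _.
by congr (_ ^+ 2); rewrite !mxE; apply: eq_bigr => j _; rewrite !mxE mulrC.
Qed.

Lemma qform_sample_cov_ge0 (n d : nat) (X : n.-tuple (d.-tuple R)) u :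
  0 <= qform (sample_cov X) u.
Proof.
rewrite qform_sample_cov mulr_ge0 ?invr_ge0 ?ler0n//.
by apply: sumr_ge0 => i _; rewrite sqr_ge0.
Qed.

Lemma qform_gt0_unitmx (d : nat) (A : 'M[R]_d) :
  (forall u, u != 0 -> 0 < qform A u) -> A \in unitmx.
Proof.
move=> Apos; rewrite -row_free_unit -kermx_eq0; apply/eqP/row_matrixP => i.
rewrite row0; apply/eqP/negPn/negP => ki0.
have /Apos : (row i (kermx A))^T != 0.
  by apply: contra_neq ki0 => /(congr1 trmx); rewrite trmxK trmx0.
by rewrite /qform trmxK -row_mul mulmx_ker row0 mul0mx mxE ltxx.
Qed.

(* [u^T B^-1 u = max_x (2 u^T x - x^T B x)], attained at [x = B^-1 u]. *)
Lemma loewner_le_invmx (d : nat) (A B : 'M[R]_d) :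
  A^T = A -> B^T = B -> A \in unitmx -> B \in unitmx ->
  (forall u, 0 <= qform A u) -> loewner_le A B ->
  loewner_le (invmx B) (invmx A).
Proof.
move=> sA sB uA uB Age0 AB u.
pose x := invmx B *m u; pose y := invmx A *m u.
have sV (M : 'M[R]_d) : M^T = M -> (invmx M)^T = invmx M.
  by move=> sM; rewrite trmx_inv sM.
have Bx : qform B x = qform (invmx B) u.
  by rewrite /x qform_mulmx sV// mulVmx// mul1mx.
have Ay : qform A y = qform (invmx A) u.
  by rewrite /y qform_mulmx sV// mulVmx// mul1mx.
have xy : bform A x y = qform (invmx B) u.
  by rewrite /bform /y mulmxA mulmxK// /x trmx_mul sV.
have := Age0 (x - y); rewrite (qformBv _ _ sA) xy Ay.
by have := AB x; rewrite Bx; lra.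
Qed.

Lemma mxtrace_conj_qform (d k : nat) (T : 'M[R]_(d, k)) (N : 'M[R]_d) :
  \tr (T^T *m N *m T) = \sum_j qform N (col j T).
Proof.
rewrite /mxtrace; apply: eq_bigr => j _.
by rewrite /qform tr_col -row_mul !mxE; apply: eq_bigr => i _; rewrite !mxE.
Qed.

Lemma loewner_le_mxtrace (d k : nat) (T : 'M[R]_(d, k)) (N N' : 'M[R]_d) :
  loewner_le N N' -> \tr (T^T *m N *m T) <= \tr (T^T *m N' *m T).
Proof. by move=> NN'; rewrite !mxtrace_conj_qform; apply: ler_sum => j _. Qed.

End qform_theory.

(** * Square roots and pseudo-inverses of matrices *)

Section psd_sqrt_theory.
Context {R : realType}.

Lemma interpolation (F : fieldType) (s : seq F) (f : F -> F) :
  exists p : {poly F}, {in s, forall x, p.[x] = f x}.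
Proof.
elim: s => [|x s [p ps]]; first by exists 0.
have [xs|xs] := boolP (x \in s).
  by exists p => y; rewrite inE => /predU1P[->|]; exact: ps.
pose N := \prod_(y <- s) ('X - y%:P).
have N0 : N.[x] != 0 by rewrite -[_ == 0]/(root N x) root_prod_XsubC.
exists (p + ((f x - p.[x]) / N.[x])%:P * N) => y.
rewrite inE hornerD hornerM hornerC => /predU1P[->|ys].
  by rewrite divfK// addrCA subrr addr0.
have /eqP -> : root N y by rewrite root_prod_XsubC.
by rewrite mulr0 addr0 ps.
Qed.

Lemma eigenvalue_psd_ge0 (d : nat) (A : 'M[R]_d) a :
  (forall u, 0 <= qform A u) -> eigenvalue A a -> 0 <= a.
Proof.
move=> A0 /eigenvalueP[v vA v0].
have v0' : v^T != 0 by apply: contra_neq v0 => /(congr1 trmx); rewrite trmxK trmx0.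
have := A0 v^T; rewrite /qform trmxK vA -scalemxAl mxE.
have -> : (v *m v^T) ord0 ord0 = qform 1%:M v^T by rewrite /qform trmxK mulmx1.
by rewrite pmulr_lge0// qform1_gt0.
Qed.

Local Open Scope sesquilinear_scope.

Lemma trmx_horner (d : nat) (A : 'M[R]_d.+1) p : A^T = A -> (horner_mx A p)^T = horner_mx A p.
Proof.
move=> sA; elim/poly_ind: p => [|p c ih]; first by rewrite rmorph0 trmx0.
rewrite rmorphD rmorphM/= horner_mx_X horner_mx_C linearD/= tr_scalar_mx.
congr (_ + _); rewrite -[LHS]/((horner_mx A p *m A)^T) trmx_mul ih sA.
exact: comm_mx_horner.
Qed.

(* With [p] interpolating the fourth root at the eigenvalues of [A],
   [p(A) ^ 2] is a square root of [A] and is visibly a Gram matrix. *)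
Lemma psd_sqrt_exists_in (C : numClosedFieldType) (f : {rmorphism R -> C})
    (d : nat) (A : 'M[R]_d.+1) :
  (forall x, f x \is Num.real) -> (forall c, c \is Num.real -> exists x, c = f x) ->
  psd A -> exists M, psd M /\ M *m M = A.
Proof.
move=> freal fonto [sA A0]; pose Ac := map_mx f A.
have Aherm : Ac \is hermsymmx.
  apply: realsym_hermsym.
    apply/is_hermitianmxP; rewrite expr0 scale1r; apply/matrixP => i j.
    by rewrite !mxE -[in LHS]sA mxE.
  by apply/mxOverP => i j; rewrite mxE.
have Areal := hermitian_spectral_diag_real Aherm.
have /hermitian_normalmx /orthomx_spectralP A_eq := Aherm.
have Puni := spectral_unit Ac.
move: (spectralmx Ac) (spectral_diag Ac) => P D in Areal A_eq Puni.
have Dev i : exists2 l : R, 0 <= l & D 0 i = f l.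
  have /mxOverP/(_ 0 i)/fonto[l Dl] := Areal; exists l => //.
  apply: (eigenvalue_psd_ge0 A0).
  rewrite eigenvalue_root_char -(fmorph_root f) map_char_poly.
  rewrite -eigenvalue_root_char -Dl.
  apply/eigenvalueP; exists (row i P).
    have PA : P *m Ac = diag_mx D *m P by rewrite {1}A_eq !mulmxA mulmxV// mul1mx.
    by rewrite -row_mul PA row_mul row_diag_mx -scalemxAl -rowE.
  apply/negP => /eqP Pi0; move: (Puni); rewrite -row_free_unit => /row_freeP[Q PQ].
  have := congr1 (row i) PQ; rewrite row_mul Pi0 mul0mx => /rowP/(_ i).
  by rewrite !mxE eqxx => /esym/eqP; rewrite oner_eq0.
have /choice[l /all_and2[l0 Dl]] : forall i, exists l, 0 <= l /\ D 0 i = f l.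
  by move=> i; have [x x0 Dx] := Dev i; exists x.
have [p pD] := interpolation [seq l i | i <- enum 'I_d.+1]
  (fun x => Num.sqrt (Num.sqrt x)).
pose N := horner_mx A p.
have sN : N^T = N by exact: trmx_horner.
exists (N *m N); split.
  split; first by rewrite trmx_mul sN.
  by move=> u; rewrite -{1}sN qform_gram_ge0.
apply: (map_mx_inj (f := f)).
pose E : 'rV[C]_d.+1 := \row_i f (Num.sqrt (Num.sqrt (l i))).
have NE : map_mx f N = invmx P *m diag_mx E *m P.
  rewrite /N map_horner_mx -[map_mx _ A]/Ac A_eq.
  rewrite horner_mx_uconjC// horner_mx_diag; congr (_ *m diag_mx _ *m _).
  apply/rowP => i; rewrite !mxE Dl horner_map/= pD//.
  by apply/mapP; exists i; rewrite ?mem_enum.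
have PVP (X Y : 'M[C]_d.+1) : invmx P *m X *m P *m (invmx P *m Y *m P) =
    invmx P *m (X *m Y) *m P.
  by rewrite !mulmxA mulmxK.
rewrite map_mxM/= map_mxM/= NE !PVP -[map_mx _ A]/Ac A_eq.
congr (_ *m _ *m _); rewrite !mulmx_diag; congr diag_mx.
apply/rowP => i; rewrite !mxE Dl -!rmorphM/=; congr (f _).
by rewrite -!expr2 !sqr_sqrtr ?sqrtr_ge0.
Qed.

Lemma psd_sqrt_exists (d : nat) (A : 'M[R]_d) : psd A ->
  exists M, psd M /\ M *m M = A.
Proof.
case: d A => [|d] A psdA.
  exists 0; split; last by apply/matrixP => -[].
  by split=> [|u]; [rewrite trmx0|rewrite /qform mulmx0 mul0mx mxE].
apply: (@psd_sqrt_exists_in _ (real_complex R)) psdA => [x|c].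
  by apply/complex_realP; exists x.
by move/complex_realP.
Qed.

Lemma psd_sqrtP (d : nat) (A : 'M[R]_d) : psd A ->
  psd (psd_sqrt A) /\ psd_sqrt A *m psd_sqrt A = A.
Proof. by move=> /psd_sqrt_exists h; exact: (@xgetPex _ 0 _ h). Qed.

Lemma row_free_gram_unitmx (m n : nat) (G : 'M[R]_(m, n)) :
  row_free G -> G *m G^T \in unitmx.
Proof.
move=> Gfree; apply: qform_gt0_unitmx => u u0.
rewrite -{1}[G]trmxK lt_def qform_gram_ge0 andbT; apply: contra_neq u0 => h.
have Gu : G^T *m u = 0.
  by apply: qform1_eq0; rewrite qform_mulmx mulmx1.
apply: trmx_inj; rewrite trmx0; apply: (row_free_inj Gfree).
by rewrite mul0mx -[G]trmxK -trmx_mul Gu trmx0.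
Qed.

(* From a rank factorization [A = F G] one gets [A^+ = G^T (G G^T)^-1 (F^T F)^-1 F^T]. *)
Lemma mp_pinv_exists (d : nat) (A : 'M[R]_d) :
  exists B, A *m B *m A = A /\ B *m A *m B = B /\
            (A *m B)^T = A *m B /\ (B *m A)^T = B *m A.
Proof.
pose F := col_base A; pose G := row_base A.
have AE : A = F *m G by rewrite mulmx_base.
move: F G AE (row_base_free A : row_free G) (col_base_full A : row_full F).
move: (\rank A) => k F G AE Gfree Ffull.
have uG : G *m G^T \in unitmx.
  exact: row_free_gram_unitmx.
have uF : F^T *m F \in unitmx.
  rewrite -{2}[F]trmxK; apply: row_free_gram_unitmx.
  by rewrite /row_free mxrank_tr.
pose K := invmx (G *m G^T); pose H := invmx (F^T *m F).
have GK : G *m G^T *m K = 1%:M by rewrite mulmxV.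
have HF : H *m (F^T *m F) = 1%:M by rewrite mulVmx.
have sK : K^T = K by rewrite trmx_inv trmx_mul trmxK.
have sH : H^T = H by rewrite trmx_inv trmx_mul trmxK.
pose B := G^T *m K *m H *m F^T.
have AB : A *m B = F *m H *m F^T.
  rewrite AE /B -!mulmxA (mulmxA G G^T) (mulmxA (G *m G^T) K) GK mul1mx.
  by rewrite !mulmxA.
have BA : B *m A = G^T *m K *m G.
  by rewrite AE /B -!mulmxA (mulmxA F^T F) (mulmxA H) HF mul1mx.
exists B; split; last split; last split.
- by rewrite AB {1}AE -!mulmxA (mulmxA F^T F) (mulmxA H) HF mul1mx AE.
- rewrite BA /B -!mulmxA (mulmxA G G^T) (mulmxA (G *m G^T) K) GK mul1mx.
  by rewrite !mulmxA.
- by rewrite AB !trmx_mul trmxK sH mulmxA.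
- by rewrite BA !trmx_mul trmxK sK mulmxA.
Qed.

Lemma mp_pinvP (d : nat) (A : 'M[R]_d) (B := mp_pinv A) :
  A *m B *m A = A /\ B *m A *m B = B /\
  (A *m B)^T = A *m B /\ (B *m A)^T = B *m A.
Proof. exact: (@xgetPex _ 0 _ (mp_pinv_exists A)). Qed.

End psd_sqrt_theory.

(** * A net of the Euclidean ball *)

Section grid_net.
Context {R : realType}.

(* Signs and magnitudes of the grid [Z^d / (4 sqrt d)], which is [1/4]-dense. *)
Definition net_index (d : nat) := {ffun 'I_d -> bool * 'I_(4 * d).+1}.

Definition net_point (d : nat) (f : net_index d) : 'cV[R]_d :=
  \col_i ((-1) ^+ (f i).1 * ((f i).2 : nat)%:R / (4 * Num.sqrt d%:R)).

Definition in_net (d : nat) (f : net_index d) :=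
  (\sum_(i < d) ((f i).2 : nat) ^ 2 <= 16 * d)%N.

Lemma qform1_net_point (d : nat) (f : net_index d) : (0 < d)%N -> in_net f ->
  qform 1%:M (net_point f) <= 1.
Proof.
move=> d0 fN; rewrite qform1.
have sd : Num.sqrt (d%:R : R) ^+ 2 = d%:R by rewrite sqr_sqrtr.
have -> : \sum_i net_point f i ord0 ^+ 2 =
    (\sum_(i < d) ((f i).2 : nat) ^ 2)%N%:R / (16 * d%:R).
  rewrite natr_sum mulr_suml; apply: eq_bigr => i _.
  rewrite mxE expr_div_n exprMn sqrr_sign mul1r exprMn sd natrX.
  by congr (_ / (_ * _)); ring.
by rewrite ler_pdivrMr ?mulr_gt0 ?ltr0n// mul1r -natrM ler_nat.
Qed.

Lemma sum_pow2_le (m : nat) : \sum_(k < m) (2^-1 : R) ^+ k <= 2.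
Proof.
have -> : \sum_(k < m) (2^-1 : R) ^+ k = 2 - 2 * 2^-1 ^+ m.
  elim: m => [|m ih]; first by rewrite big_ord0 expr0; lra.
  rewrite big_ord_recr/= ih exprS; lra.
by rewrite lerBlDr lerDl mulr_ge0// exprn_ge0// invr_ge0.
Qed.

(* The cardinality is at most [\sum_f 2 ^ (16 d - \sum_i k_i)], which factorizes. *)
Lemma card_net_le (d : nat) : (#|[pred f : net_index d | in_net f]|)%:R <= 2 ^+ (18 * d) :> R.
Proof.
apply: (@le_trans _ _ (\sum_(f : net_index d) 2 ^+ (16 * d) * \prod_i (2^-1 : R) ^+ (f i).2)).
  rewrite -sum1_card natr_sum [leLHS]big_mkcond/=; apply: ler_sum => f _.
  case: ifPn => fN; last first.
    by rewrite mulr_ge0 ?exprn_ge0//; apply: prodr_ge0 => i _; rewrite exprn_ge0 ?invr_ge0.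
  rewrite -expr_sum exprVn ler_pdivlMr ?exprn_gt0// mul1r ler_eXn2l ?ltr1n//.
  rewrite (leq_trans _ fN)//=; apply: leq_sum => i _.
  by case: (nat_of_ord _) => // m; rewrite expnS expn1 leq_pmulr.
rewrite -mulr_sumr.
have -> : \sum_(f : net_index d) \prod_i (2^-1 : R) ^+ (f i).2 =
    \prod_(i < d) \sum_(b : bool * 'I_(4 * d).+1) (2^-1 : R) ^+ b.2.
  by rewrite bigA_distr_bigA.
rewrite prodr_const card_ord.
have h : \sum_(b : bool * 'I_(4 * d).+1) (2^-1 : R) ^+ b.2 <= 4.
  rewrite -(pair_bigA _ (fun (b : bool) (k : 'I_(4 * d).+1) => (2^-1 : R) ^+ k))/=.
  rewrite big_bool/= (le_trans (lerD (sum_pow2_le _) (sum_pow2_le _)))//; lra.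
have -> : (2 : R) ^+ (18 * d) = 2 ^+ (16 * d) * 4 ^+ d.
  by rewrite (_ : 4 = 2 ^+ 2 :> R) -?exprM -?exprD; [congr (_ ^+ _); lia|ring].
rewrite ler_pM2l ?exprn_gt0// lerXn2r ?nnegrE//.
by apply: sumr_ge0 => b _; rewrite exprn_ge0 ?invr_ge0.
Qed.

Lemma net_approx (d : nat) (u : 'cV[R]_d) : (0 < d)%N -> qform 1%:M u <= 1 ->
  exists f : net_index d, [/\ in_net f, 16 * qform 1%:M (u - net_point f) <= 1 &
                               qform 1%:M (u + net_point f) <= 4].
Proof.
move=> d0 u1; pose q : R := 4 * Num.sqrt d%:R.
have sd : Num.sqrt (d%:R : R) ^+ 2 = d%:R by rewrite sqr_sqrtr.
have q0 : 0 < q by rewrite mulr_gt0// sqrtr_gt0 ltr0n.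
have q2 : q ^+ 2 = 16 * d%:R by rewrite exprMn sd; ring.
pose k i := Num.truncn (q * `|u i ord0|).
have kle i : (k i)%:R <= q * `|u i ord0| by rewrite truncn_le ?mulr_ge0// ltW.
have klt i : q * `|u i ord0| < (k i).+1%:R by rewrite truncnS_gt.
have ui1 i : u i ord0 ^+ 2 <= 1.
  apply: le_trans u1; rewrite qform1 (bigD1 i)//= lerDl.
  by apply: sumr_ge0 => j _; rewrite sqr_ge0.
have kd i : (k i < (4 * d).+1)%N.
  rewrite ltnS -(ler_nat R) (le_trans (kle i))//.
  have u_1 : `|u i ord0| <= 1 by rewrite -(@ler_pXn2r _ 2)// ?nnegrE// expr1n real_normK ?num_real.
  have sdd : Num.sqrt d%:R <= d%:R :> R.
    rewrite -(@ler_pXn2r _ 2)// ?nnegrE ?sqrtr_ge0// sd expr2.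
    by rewrite ler_peMl// ler1n.
  rewrite natrM (le_trans (ler_wpM2l (ltW q0) u_1))// mulr1 /q.
  by rewrite ler_wpM2l.
pose f : net_index d := [ffun i => (u i ord0 < 0, Ordinal (kd i))].
have fE i : net_point f i ord0 = (-1) ^+ (u i ord0 < 0)%R * ((k i)%:R / q).
  by rewrite mxE ffunE/= mulrA.
have uE i : u i ord0 = (-1) ^+ (u i ord0 < 0)%R * `|u i ord0| by rewrite -numEsign.
have kq i : (k i)%:R / q <= `|u i ord0| by rewrite ler_pdivrMr// mulrC.
have kq0 i : 0 <= (k i)%:R / q by rewrite divr_ge0// ltW.
have kq1 i : `|u i ord0| - (k i)%:R / q <= q^-1.
  rewrite lerBlDr -[X in X + _]mul1r -mulrDl ler_pdivlMr// mulrC.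
  by have := klt i; rewrite -natr1; lra.
exists f; split.
- rewrite /in_net -(ler_nat R) natr_sum natrM.
  apply: (@le_trans _ _ (\sum_i (q ^+ 2 * u i ord0 ^+ 2))).
    apply: ler_sum => i _; rewrite ffunE/= natrX -(real_normK (num_real (u i ord0))) -exprMn.
    by rewrite lerXn2r ?nnegrE// mulr_ge0// ltW.
  rewrite -mulr_sumr -qform1 q2 ler_piMr ?mulr_ge0//.
- rewrite qform1 mulr_sumr; apply: (@le_trans _ _ (\sum_(i < d) (d%:R : R)^-1)); last first.
    by rewrite sumr_const card_ord -[leLHS]mulr_natl divff// pnatr_eq0 -lt0n.
  apply: ler_sum => i _; rewrite mxE mxE fE {1}uE -mulrBr exprMn sqrr_sign mul1r.
  rewrite -ler_pdivlMl// -invfM -q2 -exprVn lerXn2r ?nnegrE ?invr_ge0 ?subr_ge0//.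
  exact: ltW.
- rewrite qform1; apply: (@le_trans _ _ (\sum_i (4 * u i ord0 ^+ 2))); last first.
    by rewrite -mulr_sumr -qform1; lra.
  apply: ler_sum => i _; rewrite mxE fE {1}uE -mulrDr exprMn sqrr_sign mul1r.
  rewrite -(real_normK (num_real (u i ord0))).
  by have := kq i; have := kq0 i; nra.
Qed.

Lemma qform_net_bound (d : nat) (Q : 'M[R]_d) (t : R) : (0 < d)%N -> Q^T = Q ->
  (forall f : net_index d, in_net f -> `|qform Q (net_point f)| <= t) ->
  forall u, `|qform Q u| <= 2 * t * qform 1%:M u.
Proof.
move=> d0 sQ Qt.
pose S := [set `|qform Q u| | u in [set u : 'cV[R]_d | qform 1%:M u <= 1]].
have entry1 (u : 'cV[R]_d) i : qform 1%:M u <= 1 -> `|u i ord0| <= 1.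
  move=> u1; rewrite -(@ler_pXn2r _ 2)// ?nnegrE// expr1n real_normK ?num_real//.
  apply: le_trans u1; rewrite qform1 (bigD1 i)//= lerDl.
  by apply: sumr_ge0 => j _; rewrite sqr_ge0.
have supS : has_sup S.
  split; first by exists `|qform Q 0|, 0 => //=; rewrite /qform mulmx0 mxE.
  exists (\sum_i \sum_j `|Q i j|) => _ [u /= u1 <-].
  rewrite qform_expand (le_trans (ler_norm_sum _ _ _))//; apply: ler_sum => i _.
  rewrite (le_trans (ler_norm_sum _ _ _))//; apply: ler_sum => j _.
  rewrite !normrM ler_piMr// -[leRHS]mulr1; apply: ler_pM => //; exact: entry1.
pose s := sup S.
have Ss u : qform 1%:M u <= 1 -> `|qform Q u| <= s.
  by move=> u1; apply: sup_upper_bound => //; exists u.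
have s0 : 0 <= s by apply: le_trans (Ss 0 _) => //; rewrite /qform mulmx0 mxE.
have scal u : `|qform Q u| <= s * qform 1%:M u.
  have [->|u0] := eqVneq u 0; first by rewrite /qform !mulmx0 mxE normr0 mulr0.
  have p0 := qform1_gt0 u0; pose a := (Num.sqrt (qform 1%:M u))^-1.
  have a2 : a ^+ 2 = (qform 1%:M u)^-1 by rewrite exprVn sqr_sqrtr// ltW.
  have := Ss (a *: u); rewrite !qform_scalev a2 mulVf ?gt_eqF// => /(_ (lexx _)).
  by rewrite normrM ger0_norm ?invr_ge0 ?(ltW p0)// mulrC ler_pdivrMr.
have half u : qform 1%:M u <= 1 -> `|qform Q u| <= t + s / 2.
  move=> u1; have [f [fN ha hb]] := net_approx d0 u1.
  set v := net_point f in ha hb.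
  pose a : 'cV[R]_d := u - v; pose b : 'cV[R]_d := u + v.
  rewrite -/a in ha; rewrite -/b in hb.
  have uE : u = 2^-1 *: (a + b).
    apply/colP => i; rewrite /a /b !mxE; lra.
  have vE : v = 2^-1 *: (b - a).
    apply/colP => i; rewrite /a /b !mxE; lra.
  have hv := Qt f fN; rewrite -/v in hv.
  clearbody a b v.
  have Qab : qform Q u - qform Q v = (qform Q (8 *: a + b) - qform Q (8 *: a - b)) / 32.
    rewrite {1}uE {1}vE !qform_scalev !(qformBv _ _ sQ) !(qformDv _ _ sQ) !qform_scalev.
    rewrite bformZl (bformC b a)//; lra.
  have h1 := scal (8 *: a + b); have h2 := scal (8 *: a - b).
  have par : qform 1%:M (8 *: a + b) + qform 1%:M (8 *: a - b) =
      128 * qform 1%:M a + 2 * qform 1%:M b.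
    by rewrite qformDv ?trmx1// qformBv ?trmx1// !qform_scalev; lra.
  move: h1 h2 hv; rewrite !ler_norml => /andP[h1 h1'] /andP[h2 h2'] /andP[hv hv'].
  have hs : s * (qform 1%:M (8 *: a + b) + qform 1%:M (8 *: a - b)) <= s * 16.
    by rewrite ler_wpM2l// par; lra.
  rewrite mulrDr in hs.
  by apply/andP; split; lra.
have st : s <= t + s / 2.
  apply: ge_sup; first by case: supS.
  by move=> _ [u /= u1 <-]; exact: half.
move=> u; apply: (le_trans (scal u)); rewrite ler_wpM2r ?qform1_ge0//; lra.
Qed.

End grid_net.

(** * Iterated integrals and Gaussian moments *)

Section iterated_integral.
Context {R : realType} (dT : measure_display) (T : measurableType dT).
Variable mu : probability T R.
Local Open Scope ereal_scope.

Lemma eq_iter_int (n : nat) (f g : n.-tuple T -> \bar R) :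
  f =1 g -> iter_int mu f = iter_int mu g.
Proof. by move=> /funext ->. Qed.

Lemma iter_int_ge0 (n : nat) (f : n.-tuple T -> \bar R) :
  (forall t, 0 <= f t) -> 0 <= iter_int mu f.
Proof.
elim: n f => [|n ih] f f0 //=.
by apply: integral_ge0 => x _; exact: ih.
Qed.

Lemma measurable_cons_tuple (n : nat) (dX : measure_display) (X : measurableType dX)
    (f : X -> T) (g : X -> n.-tuple T) :
  measurable_fun setT f -> measurable_fun [set: X] g ->
  measurable_fun [set: X] (fun x => cons_tuple (f x) (g x)).
Proof. by move=> mf mg; exact: measurable_cons. Qed.

Lemma measurable_iter_int (n : nat) (dX : measure_display) (X : measurableType dX)
    (f : X * n.-tuple T -> \bar R) :
  (forall z, 0 <= f z) -> measurable_fun [set: X * n.-tuple T] f ->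
  measurable_fun setT (fun x => iter_int mu (fun t => f (x, t))).
Proof.
elim: n dX X f => [|n ih] dX X f f0 mf /=.
  by apply: (measurableT_comp mf); exact: measurable_fun_pair.
pose g (z : (X * T) * n.-tuple T) := f (z.1.1, cons_tuple z.1.2 z.2).
have mg : measurable_fun [set: (X * T) * n.-tuple T] g.
  apply: (measurableT_comp mf); apply: measurable_fun_pair.
    exact: measurableT_comp.
  apply: measurable_cons_tuple => //; exact: measurableT_comp.
have := ih _ _ g (fun z => f0 _) mg => mG.
apply: (@measurable_fun_fubini_tonelli_F _ _ _ _ _ mu
  (fun z => iter_int mu (fun t => g (z, t)))) => //.
by move=> z; apply: iter_int_ge0 => t; exact: f0.
Qed.

Lemma measurable_iter_int_cons (n : nat) (f : n.+1.-tuple T -> \bar R) :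
  (forall z, 0 <= f z) -> measurable_fun [set: n.+1.-tuple T] f ->
  measurable_fun setT (fun x => iter_int mu (fun t : n.-tuple T => f (cons_tuple x t))).
Proof.
move=> f0 mf.
apply: (@measurable_iter_int n _ _ (fun z => f (cons_tuple z.1 z.2))) => //.
by apply: (measurableT_comp mf); exact: measurable_cons_tuple.
Qed.

Lemma measurable_cons_app (n : nat) (f : n.+1.-tuple T -> \bar R) x :
  measurable_fun [set: n.+1.-tuple T] f ->
  measurable_fun [set: n.-tuple T] (fun t : n.-tuple T => f (cons_tuple x t)).
Proof. by move=> mf; apply: (measurableT_comp mf); exact: measurable_cons_tuple. Qed.

Lemma iter_intD (n : nat) (f g : n.-tuple T -> \bar R) :
  (forall t, 0 <= f t) -> (forall t, 0 <= g t) ->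
  measurable_fun [set: n.-tuple T] f -> measurable_fun [set: n.-tuple T] g ->
  iter_int mu (fun t => f t + g t) = iter_int mu f + iter_int mu g.
Proof.
elim: n f g => [//|n ih] f g f0 g0 mf mg /=.
rewrite -ge0_integralD//=; last 4 first.
- by move=> x _; exact: iter_int_ge0.
- exact: measurable_iter_int_cons.
- by move=> x _; exact: iter_int_ge0.
- exact: measurable_iter_int_cons.
by apply: eq_integral => x _; rewrite ih//; exact: measurable_cons_app.
Qed.

Lemma iter_int_sum (n : nat) (I : Type) (s : seq I) (f : I -> n.-tuple T -> \bar R) :
  (forall i t, 0 <= f i t) -> (forall i, measurable_fun [set: n.-tuple T] (f i)) ->
  iter_int mu (fun t => \sum_(i <- s) f i t) = \sum_(i <- s) iter_int mu (f i).
Proof.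
move=> f0 mf; elim: s => [|i s ih].
  rewrite big_nil (@eq_iter_int _ _ (cst 0)) => [|t]; last by rewrite big_nil.
  by elim: n {f f0 mf} => [//|n ih]/=; rewrite integral0_eq.
rewrite big_cons -ih -iter_intD//; last 2 first.
- by move=> t; exact: sume_ge0.
- exact: emeasurable_sum.
by apply: eq_iter_int => t; rewrite big_cons.
Qed.

Lemma le_iter_int (n : nat) (f g : n.-tuple T -> \bar R) :
  (forall t, 0 <= f t) ->
  measurable_fun [set: n.-tuple T] f -> measurable_fun [set: n.-tuple T] g ->
  (forall t, f t <= g t) -> iter_int mu f <= iter_int mu g.
Proof.
elim: n f g => [//|n ih] f g f0 mf mg fg /=; first exact: fg.
apply: ge0_le_integral => //.
- by move=> x _; exact: iter_int_ge0.
- exact: measurable_iter_int_cons.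
- by apply: measurable_iter_int_cons => // z; exact: le_trans (fg z).
- by move=> x _; apply: ih => //; exact: measurable_cons_app.
Qed.

Lemma iter_intZ (n : nat) (f : n.-tuple T -> \bar R) c :
  0 <= c -> (forall t, 0 <= f t) -> measurable_fun [set: n.-tuple T] f ->
  iter_int mu (fun t => c * f t) = c * iter_int mu f.
Proof.
move=> c0; elim: n f => [//|n ih] f f0 mf /=.
rewrite -ge0_integralZl//=; last 2 first.
- exact: measurable_iter_int_cons.
- by move=> x _; exact: iter_int_ge0.
by apply: eq_integral => x _; rewrite ih//; exact: measurable_cons_app.
Qed.

Lemma iter_int_prod (n : nat) (g : T -> R) (m : R) (c : R) :
  (forall x, 0 <= g x)%R -> (0 <= c)%R -> measurable_fun setT g ->
  \int[mu]_x (g x)%:E = m%:E ->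
  iter_int mu (fun t : n.-tuple T => (c * \prod_i g (tnth t i))%:E) = (c * m ^+ n)%:E.
Proof.
move=> g0 c0 mg gm; elim: n c c0 => [|n ih] c c0 /=.
  by rewrite big_ord0 expr0.
transitivity (\int[mu]_x ((c * m ^+ n)%:E * (g x)%:E)); last first.
  rewrite ge0_integralZl//; last 3 first.
  - exact/measurable_EFinP.
  - by move=> x _; rewrite lee_fin.
  - rewrite lee_fin mulr_ge0// exprn_ge0// -lee_fin -gm.
    by apply: integral_ge0 => x _; rewrite lee_fin.
  by rewrite gm -EFinM exprSr mulrA.
apply: eq_integral => x _.
transitivity (iter_int mu (fun t : n.-tuple T => ((c * g x) * \prod_i g (tnth t i))%:E)).
  apply: eq_iter_int => t; rewrite big_ord_recl tnth0 mulrA.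
  by congr ((_ * _)%:E); apply: eq_bigr => i _; rewrite tnthS.
by rewrite ih ?mulr_ge0// -EFinM; congr (_%:E); ring.
Qed.

End iterated_integral.

Section integral_affine.
Context {R : realType} (dT : measure_display) (T : measurableType dT).
Variable mu : probability T R.

Lemma integrable_cst_prob (c : R) : mu.-integrable setT (fun=> c%:E).
Proof. exact: finite_measure_integrable_cst. Qed.

Lemma integrable_affine2 (f g : T -> R) (c0 c1 c2 : R) :
  mu.-integrable setT (EFin \o f) -> mu.-integrable setT (EFin \o g) ->
  mu.-integrable setT (fun x => (c0 + c1 * f x + c2 * g x)%:E).
Proof.
move=> intf intg.
rewrite (_ : (fun x => _) = (fun x => (c0%:E + c1%:E * (f x)%:E) + c2%:E * (g x)%:E)%E)//.
apply: integrableD => //; last exact: integrableZl.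
by apply: integrableD => //; [exact: integrable_cst_prob|exact: integrableZl].
Qed.

Lemma integral_affine2 (f g : T -> R) (F G c0 c1 c2 : R) :
  mu.-integrable setT (EFin \o f) -> mu.-integrable setT (EFin \o g) ->
  (\int[mu]_x (f x)%:E = F%:E)%E -> (\int[mu]_x (g x)%:E = G%:E)%E ->
  (\int[mu]_x (c0 + c1 * f x + c2 * g x)%:E = (c0 + c1 * F + c2 * G)%:E)%E.
Proof.
move=> intf intg fF gG.
transitivity (\int[mu]_x ((c0%:E + c1%:E * (f x)%:E) + c2%:E * (g x)%:E))%E => //.
have i1 : mu.-integrable setT (fun x => c1%:E * (f x)%:E)%E by exact: integrableZl.
have i2 : mu.-integrable setT (fun x => c2%:E * (g x)%:E)%E by exact: integrableZl.
have i0 := integrable_cst_prob c0.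
rewrite integralD//; last exact: integrableD.
rewrite integralD// integralZl// integralZl// fF gG integral_cst//.
transitivity (c0%:E * 1 + c1%:E * F%:E + c2%:E * G%:E)%E; last by rewrite mule1.
by congr (_ * _ + _ + _)%E; exact: probability_setT.
Qed.

End integral_affine.

Section normal_moments.
Context {R : realType}.
Local Notation leb := (@lebesgue_measure R).

Lemma ge0_integral_normal_prob (m s : R) (f : R -> \bar R) :
  (forall x, 0 <= f x)%E -> measurable_fun setT f ->
  (\int[normal_prob m s]_x f x = \int[leb]_x (f x * (normal_pdf m s x)%:E))%E.
Proof.
move=> f0 mf.
have dom := @normal_prob_dominates R m s.
rewrite -(Radon_Nikodym_SigmaFinite.change_of_variables dom)//=.
apply: ae_eq_integral => //.
- apply: emeasurable_funM => //; apply: (measurable_int leb).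
  exact: Radon_Nikodym_SigmaFinite.f_integrable.
- apply: emeasurable_funM => //; apply/measurable_EFinP; exact: measurable_normal_pdf.
- apply: ae_eqe_mul2l; apply: integral_ae_eq => //.
  + exact: Radon_Nikodym_SigmaFinite.f_integrable.
  + by apply/measurable_EFinP; exact: measurable_normal_pdf.
  + by move=> E _ mE; rewrite -Radon_Nikodym_SigmaFinite.f_integral.
Qed.

Lemma normal_pdf0E (m s x : R) : 0 < s ->
  normal_pdf m s x = (s * Num.sqrt (pi *+ 2))^-1 * expR (- (x - m) ^+ 2 / (s ^+ 2 *+ 2)).
Proof.
move=> s0; rewrite normal_pdfE ?gt_eqF// /normal_peak /normal_fun; congr (_^-1 * _).
by rewrite -mulrnAr sqrtrM ?sqr_ge0// sqrtr_sqr gtr0_norm.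
Qed.

Lemma measurable_expR_quad (a b : R) :
  measurable_fun setT (fun x : R => (expR (a * x ^+ 2 + b * x))%:E).
Proof.
apply/measurable_EFinP/measurableT_comp => //.
by apply: measurable_funD; exact: measurable_funM.
Qed.

Lemma integral_normal_expR_sqr (sigma s : R) : 0 < sigma -> 0 < s ->
  (\int[normal_prob 0 sigma]_x (expR (- ((s ^- 2 - sigma ^- 2) / 2 * x ^+ 2)))%:E =
   (s / sigma)%:E)%E.
Proof.
move=> sg0 s0; set a := (_ - _) / 2.
have mE : measurable_fun setT (fun x : R => (expR (- (a * x ^+ 2)))%:E).
  rewrite (_ : (fun x : R => _) = (fun x : R => (expR (- a * x ^+ 2 + 0 * x))%:E)).
    exact: measurable_expR_quad.
  by apply/funext => x; rewrite mul0r addr0 mulNr.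
rewrite ge0_integral_normal_prob//.
transitivity (\int[leb]_x ((s / sigma)%:E * (normal_pdf 0 s x)%:E))%E; last first.
  rewrite ge0_integralZl ?integral_normal_pdf ?mule1//.
  - by apply/measurable_EFinP; exact: measurable_normal_pdf.
  - by move=> x _; rewrite lee_fin normal_pdf_ge0.
  - by rewrite lee_fin divr_ge0// ltW.
apply: eq_integral => x _; rewrite -!EFinM; congr (_%:E).
rewrite !normal_pdf0E// !subr0 mulrCA -expRD [RHS]mulrA; congr (_ * expR _).
  by field; rewrite ?gt_eqF//= sqrtr_gt0 mulrn_wgt0// pi_gt0.
by rewrite /a -!(mulr_natr (_ ^+ 2)); field; rewrite !gt_eqF.
Qed.

Lemma integral_normal_expR (sigma t : R) : 0 < sigma ->
  (\int[normal_prob 0 sigma]_x (expR (t * x))%:E =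
   (expR (t ^+ 2 * sigma ^+ 2 / 2))%:E)%E.
Proof.
move=> sg0.
rewrite ge0_integral_normal_prob//; last first.
  by apply/measurable_EFinP/measurableT_comp => //; exact: measurable_funM.
transitivity (\int[leb]_x ((expR (t ^+ 2 * sigma ^+ 2 / 2))%:E *
    (normal_pdf (t * sigma ^+ 2) sigma x)%:E))%E; last first.
  rewrite ge0_integralZl ?integral_normal_pdf ?mule1//.
  - by apply/measurable_EFinP; exact: measurable_normal_pdf.
  - by move=> x _; rewrite lee_fin normal_pdf_ge0.
apply: eq_integral => x _; rewrite -!EFinM; congr (_%:E).
rewrite !normal_pdf0E// subr0 mulrCA -expRD [RHS]mulrCA -expRD; congr (_ * expR _).
by rewrite -!(mulr_natr (_ ^+ 2)); field; rewrite gt_eqF.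
Qed.

Lemma integrable_normal_sqr (sigma : R) : 0 < sigma ->
  (normal_prob 0 sigma).-integrable setT (fun x : R => (x ^+ 2)%:E).
Proof.
move=> sg0; pose s := 2 * sigma; have s0 : 0 < s by rewrite mulr_gt0.
pose a : R := - ((s ^- 2 - sigma ^- 2) / 2).
have aE : a = 3 / 8 * sigma ^- 2 by rewrite /a /s; field; rewrite gt_eqF.
have a0 : 0 < a by rewrite aE mulr_gt0// ?invr_gt0 ?exprn_gt0//; lra.
have mE : measurable_fun setT (fun x : R => (expR (a * x ^+ 2))%:E).
  rewrite (_ : (fun x : R => _) = (fun x : R => (expR (a * x ^+ 2 + 0 * x))%:E)).
    exact: measurable_expR_quad.
  by apply/funext => x; rewrite mul0r addr0.
have int : (normal_prob 0 sigma).-integrable setT (fun x : R => (expR (a * x ^+ 2))%:E).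
  apply/integrableP; split => //.
  under eq_integral do rewrite gee0_abs ?lee_fin ?expR_ge0//.
  rewrite [X in (X < _)%E](_ : _ = (s / sigma)%:E) ?ltry//.
  rewrite -(integral_normal_expR_sqr sg0 s0); apply: eq_integral => x _.
  by rewrite /a mulNr.
apply: (@le_integrable _ _ _ (normal_prob 0 sigma) setT _ (fun x : R => (x ^+ 2)%:E)
  (fun x : R => (a^-1)%:E * (expR (a * x ^+ 2))%:E)%E) => //.
- by apply/measurable_EFinP; exact: measurable_funX.
- move=> x _; rewrite -EFinM !abse_EFin lee_fin !ger0_norm ?sqr_ge0//; last first.
    by rewrite mulr_ge0 ?expR_ge0// invr_ge0 ltW.
  rewrite ler_pdivlMl//; apply: le_trans (expR_ge1Dx _); lra.
- exact: integrableZl.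
Qed.

Lemma integrable_normal_id (sigma : R) : 0 < sigma ->
  (normal_prob 0 sigma).-integrable setT (fun x : R => x%:E).
Proof.
move=> sg0.
apply: (@le_integrable _ _ _ (normal_prob 0 sigma) setT _ (fun x : R => x%:E)
  (fun x : R => (1 + 0 * x ^+ 2 + 1 * x ^+ 2)%:E)) => //.
- exact/measurable_EFinP.
- move=> x _; rewrite !abse_EFin lee_fin mul0r addr0 mul1r [leRHS]ger0_norm; last first.
    by rewrite addr_ge0 ?sqr_ge0.
  by rewrite -(real_normK (num_real x)); have := normr_ge0 x; nra.
- by apply: integrable_affine2; exact: integrable_normal_sqr.
Qed.

Lemma integral_normal_id (sigma : R) : 0 < sigma ->
  (\int[normal_prob 0 sigma]_x x%:E = 0)%E.
Proof.
move=> sg0; have intx := integrable_normal_id sg0.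
have fm : (\int[normal_prob 0 sigma]_x x%:E)%E \is a fin_num by exact: integrable_fin_num.
set m := fine (\int[normal_prob 0 sigma]_x x%:E)%E.
have mE : (\int[normal_prob 0 sigma]_x x%:E = m%:E)%E by rewrite fineK.
have key t : 1 + t * m <= expR (t ^+ 2 * sigma ^+ 2 / 2).
  rewrite -lee_fin -integral_normal_expR//.
  have := integral_affine2 1 t 0 intx intx mE mE; rewrite mul0r addr0 => <-.
  apply: le_integral => //.
  - exact: integrable_affine2.
  - apply/integrableP; split.
      by apply/measurable_EFinP/measurableT_comp => //; exact: measurable_funM.
    under eq_integral do rewrite gee0_abs ?lee_fin ?expR_ge0//.
    by rewrite integral_normal_expR// ltry.
  - by move=> x _; rewrite lee_fin mul0r addr0 expR_ge1Dx.
have key2 t : t ^+ 2 * sigma ^+ 2 <= 1 -> t * m <= t ^+ 2 * sigma ^+ 2.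
  move=> t1; have := key t; set y := t ^+ 2 * sigma ^+ 2 in t1 *.
  have y0 : 0 <= y by rewrite mulr_ge0 ?sqr_ge0.
  have : expR (y / 2) * (1 - y / 2) <= 1.
    rewrite -[leRHS](expRxMexpNx_1 (y / 2)) ler_wpM2l ?expR_ge0//.
    by have := expR_ge1Dx (- (y / 2)); lra.
  set e := expR (y / 2) => h1 h2.
  nra.
have small e : 0 < e -> e * sigma <= 1 -> `|m| <= e * sigma ^+ 2.
  move=> e0 e1.
  have e2 : e ^+ 2 * sigma ^+ 2 <= 1.
    by rewrite -exprMn exprn_ile1// mulr_ge0// ltW.
  have h1 := key2 e e2; have := key2 (- e); rewrite sqrrN => /(_ e2) h2.
  by rewrite ler_norml; apply/andP; split; rewrite -(ler_pM2l e0); nra.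
rewrite mE; congr (_%:E); apply/eqP; rewrite -normr_eq0 eq_le normr_ge0 andbT.
apply/ler_addgt0Pl => eps eps0; rewrite addr0.
pose e := Num.min (sigma^-1) (eps / sigma ^+ 2).
have e0 : 0 < e by rewrite lt_min invr_gt0 sg0 divr_gt0// exprn_gt0.
apply: le_trans (small e e0 _) _.
  by rewrite -ler_pdivlMr// mul1r ge_min lexx.
by rewrite -ler_pdivlMr ?exprn_gt0// ge_min lexx orbT.
Qed.

Lemma integral_normal_sqr (sigma : R) : 0 < sigma ->
  (\int[normal_prob 0 sigma]_x (x ^+ 2)%:E = (sigma ^+ 2)%:E)%E.
Proof.
move=> sg0; have intx := integrable_normal_sqr sg0.
have fm : (\int[normal_prob 0 sigma]_x (x ^+ 2)%:E)%E \is a fin_num.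
  exact: integrable_fin_num.
set v := fine (\int[normal_prob 0 sigma]_x (x ^+ 2)%:E)%E.
have vE : (\int[normal_prob 0 sigma]_x (x ^+ 2)%:E = v%:E)%E by rewrite fineK.
have v0 : 0 <= v by rewrite -lee_fin -vE integral_ge0// => x _; rewrite lee_fin sqr_ge0.
have key s : 0 < s -> 1 - (s ^- 2 - sigma ^- 2) / 2 * v <= s / sigma.
  move=> s0; set a := (_ - _) / 2; rewrite -lee_fin -integral_normal_expR_sqr// -/a.
  have := integral_affine2 1 (- a) 0 intx intx vE vE; rewrite mul0r addr0 mulNr => <-.
  apply: le_integral => //.
  - exact: integrable_affine2.
  - apply/integrableP; split.
      rewrite (_ : (fun x : R => _) = (fun x : R => (expR (- a * x ^+ 2 + 0 * x))%:E)).
        exact: measurable_expR_quad.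
      by apply/funext => x; rewrite mul0r addr0 mulNr.
    under eq_integral do rewrite gee0_abs ?lee_fin ?expR_ge0//.
    by rewrite integral_normal_expR_sqr// ltry.
  - by move=> x _; rewrite lee_fin mul0r addr0 -[leLHS]/(1 + _) mulNr expR_ge1Dx.
(* With [s = sigma (1 + e)], both signs of [e] squeeze [v] around [sigma ^ 2]. *)
have key2 e : -1 < e -> 0 <= e * (2 * (1 + e) ^+ 2 * sigma ^+ 2 - (2 + e) * v).
  move=> e1; have s0 : 0 < sigma * (1 + e) by rewrite mulr_gt0//; lra.
  have := key _ s0.
  have -> : 1 - ((sigma * (1 + e)) ^- 2 - sigma ^- 2) / 2 * v =
    1 + e * (2 + e) * v / (2 * (1 + e) ^+ 2 * sigma ^+ 2).
    by field; rewrite !gt_eqF//; lra.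
  have -> : sigma * (1 + e) / sigma = 1 + e by field; rewrite gt_eqF.
  rewrite lerD2l.
  rewrite ler_pdivrMr; last by rewrite !mulr_gt0// ?exprn_gt0//; lra.
  lra.
rewrite vE; congr (_%:E); apply/eqP; rewrite eq_le; apply/andP; split.
- apply/ler_addgt0Pr => eps eps0.
  pose e := Num.min 1 (eps / (4 * sigma ^+ 2)).
  have e0 : 0 < e by rewrite lt_min ltr01 divr_gt0// mulr_gt0// exprn_gt0.
  have eeps : e * (4 * sigma ^+ 2) <= eps.
    by rewrite -ler_pdivlMr ?mulr_gt0 ?exprn_gt0// ge_min lexx orbT.
  have e1 : e <= 1 by rewrite ge_min lexx.
  have := key2 e; rewrite pmulr_rge0// => /(_ _) h.
  have {}h : 0 <= 2 * (1 + e) ^+ 2 * sigma ^+ 2 - (2 + e) * v by apply: h; lra.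
  set q := sigma ^+ 2 in eeps h *; have q0 : 0 <= q by rewrite sqr_ge0.
  nra.
- apply/ler_addgt0Pr => eps eps0.
  pose e := Num.min (2^-1) (eps / (4 * sigma ^+ 2)).
  have e0 : 0 < e by rewrite lt_min invr_gt0 ltr0n divr_gt0// mulr_gt0// exprn_gt0.
  have eeps : e * (4 * sigma ^+ 2) <= eps.
    by rewrite -ler_pdivlMr ?mulr_gt0 ?exprn_gt0// ge_min lexx orbT.
  have e1 : e <= 2^-1 by rewrite ge_min lexx.
  have := key2 (- e); rewrite mulNr oppr_ge0 pmulr_rle0// => /(_ _) h.
  have {}h : 2 * (1 - e) ^+ 2 * sigma ^+ 2 - (2 - e) * v <= 0 by apply: h; lra.
  set q := sigma ^+ 2 in eeps h *; have q0 : 0 <= q by rewrite sqr_ge0.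
  nra.
Qed.

End normal_moments.

(** * Concentration of the sample covariance *)

Section subexponential.
Context {R : realType} (dT : measure_display) (T : measurableType dT).
Variable p : probability T R.

Lemma expR_le_quadratic (x : R) : expR x <= 1 + x + x ^+ 2 * expR `|x|.
Proof.
have h : expR x - 1 <= x * expR x.
  have : expR x * (1 - x) <= 1.
    rewrite -[leRHS](expRxMexpNx_1 x) ler_wpM2l ?expR_ge0//.
    by have := expR_ge1Dx (- x); lra.
  by lra.
have h1 := expR_ge1Dx x.
have [x0|x0] := leP 0 x; first by rewrite ger0_norm//; have := expR_ge0 x; nra.
have e1 : 1 <= expR `|x| by rewrite -[leLHS]expR0 ler_expR.
have x2 : 0 <= x ^+ 2 by rewrite sqr_ge0.
by nra.
Qed.

Lemma sqr_expR_le (w : R) : 0 <= w -> w ^+ 2 <= 16 * expR (w / 2).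
Proof.
move=> w0; have -> : w / 2 = w / 4 + w / 4 by lra.
by rewrite expRD; have := expR_ge1Dx (w / 4); nra.
Qed.

(* Gaussian linearization: [exp (l y^2) = E_g exp (sqrt (2 l) y g)]. *)
Lemma integral_expR_sqr_subgaussian (rho : R) (Y : T -> R) : 0 < rho ->
  measurable_fun setT Y ->
  (forall s : R, (\int[p]_x (expR (s * Y x))%:E <= (expR (s ^+ 2 * rho ^+ 2 / 2))%:E)%E) ->
  (\int[p]_x (expR (Y x ^+ 2 / (4 * rho ^+ 2)))%:E <= (Num.sqrt 2)%:E)%E.
Proof.
move=> rho0 mY sY; pose gam : probability _ R := normal_prob (0 : R) 1.
pose a : R := (Num.sqrt 2 * rho)^-1.
have s2 : Num.sqrt 2 ^+ 2 = 2 :> R by rewrite sqr_sqrtr.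
have s20 : 0 < Num.sqrt 2 :> R by rewrite sqrtr_gt0.
have a2 : a ^+ 2 = (2 * rho ^+ 2)^-1 by rewrite exprVn exprMn s2.
have lin y : ((expR (y ^+ 2 / (4 * rho ^+ 2)))%:E = \int[gam]_g (expR ((a * y) * g))%:E)%E.
  rewrite integral_normal_expR ?ltr01//; congr ((expR _)%:E).
  by rewrite exprMn a2 expr1n; field; rewrite gt_eqF.
under eq_integral do rewrite lin.
pose f (z : T * measurableTypeR R) : \bar R := (expR ((a * Y z.1) * z.2))%:E.
have mf : measurable_fun setT f.
  apply/measurable_EFinP/measurableT_comp => //; apply: measurable_funM => //.
  by apply: measurable_funM => //; exact: measurableT_comp.
have f0 z : (0 <= f z)%E by rewrite lee_fin expR_ge0.
rewrite [leLHS](_ : _ = \int[gam]_g \int[p]_x f (x, g))%E; last first.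
  exact: (fubini_tonelli (m1 := p) (m2 := gam) f).
have gE : (\int[gam]_g (expR (4^-1 * g ^+ 2))%:E = (Num.sqrt 2)%:E)%E.
  have := @integral_normal_expR_sqr R 1 (Num.sqrt 2) ltr01 s20.
  rewrite divr1 => <-; apply: eq_integral => g _; congr ((expR _)%:E).
  by rewrite s2 expr1n; lra.
rewrite -gE; apply: ge0_le_integral => //=.
- by move=> g _; apply: integral_ge0 => x _; rewrite lee_fin expR_ge0.
- exact: (measurable_fun_fubini_tonelli_G (m1 := p) f).
- by apply/measurable_EFinP/measurableT_comp => //; exact: measurable_funM.
- move=> g _; have := sY (a * g).
  have -> : (a * g) ^+ 2 * rho ^+ 2 / 2 = 4^-1 * g ^+ 2.
    by rewrite exprMn a2; field; rewrite gt_eqF.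
  apply: le_trans; rewrite le_eqVlt; apply/orP; left; apply/eqP.
  by apply: eq_integral => x _; congr ((expR _)%:E); rewrite /= mulrAC.
Qed.

Lemma subexponential_sqr (rho q th : R) (Y : T -> R) : 0 < rho ->
  measurable_fun setT Y ->
  (forall s : R, (\int[p]_x (expR (s * Y x))%:E <= (expR (s ^+ 2 * rho ^+ 2 / 2))%:E)%E) ->
  p.-integrable setT (fun x => (Y x ^+ 2)%:E) ->
  (\int[p]_x (Y x ^+ 2)%:E = q%:E)%E ->
  q <= 2 * rho ^+ 2 /\
  (`|th| <= 2^-1 ->
   (\int[p]_x (expR (th * ((Y x ^+ 2 - q) / (4 * rho ^+ 2))))%:E
     <= (expR (32 * th ^+ 2))%:E)%E).
Proof.
move=> rho0 mY sY iY qY; pose mu : R := (4 * rho ^+ 2)^-1.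
have mu0 : 0 < mu by rewrite invr_gt0 mulr_gt0// exprn_gt0.
have q0 : 0 <= q by rewrite -lee_fin -qY integral_ge0// => x _; rewrite lee_fin sqr_ge0.
pose Z x := Y x ^+ 2 * mu; pose z0 := q * mu.
have z00 : 0 <= z0 by rewrite mulr_ge0// ltW.
have Z0 x : 0 <= Z x by rewrite mulr_ge0 ?sqr_ge0// ltW.
have mZ : measurable_fun setT Z by apply: measurable_funM => //; exact: measurable_funX.
have eZ := integral_expR_sqr_subgaussian rho0 mY sY.
have s2 : Num.sqrt 2 <= 3 / 2 :> R.
  by rewrite -(@ler_pXn2r _ 2)// ?nnegrE ?sqrtr_ge0// sqr_sqrtr//; lra.
have mEZ : measurable_fun setT (fun x => expR (Z x)) by exact: measurableT_comp.
have ieZ : p.-integrable setT (EFin \o (fun x => expR (Z x))).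
  apply/integrableP; split; first exact/measurable_EFinP.
  under eq_integral do rewrite /= ger0_norm ?expR_ge0//.
  by apply: (le_lt_trans eZ); rewrite ltry.
pose m := fine (\int[p]_x (expR (Z x))%:E)%E.
have mE : (\int[p]_x (expR (Z x))%:E = m%:E)%E by rewrite fineK// integrable_fin_num.
have m2 : m <= 3 / 2 by apply: le_trans s2; rewrite -lee_fin -mE.
have m0 : 0 <= m by rewrite -lee_fin -mE integral_ge0// => x _; rewrite lee_fin expR_ge0.
have iZ : p.-integrable setT (EFin \o Z).
  rewrite (_ : _ \o _ = (fun x => mu%:E * (Y x ^+ 2)%:E)%E); first exact: integrableZl.
  by apply/funext => x; rewrite /= -EFinM mulrC.
have ZE : (\int[p]_x (Z x)%:E = z0%:E)%E.
  transitivity (\int[p]_x (mu%:E * (Y x ^+ 2)%:E))%E.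
    by apply: eq_integral => x _; rewrite -EFinM mulrC.
  by rewrite integralZl// qY -EFinM mulrC.
have z0m : 1 + z0 <= m.
  rewrite -lee_fin -mE.
  have := integral_affine2 1 1 0 iZ iZ ZE ZE; rewrite mul1r mul0r addr0 => <-.
  apply: le_integral => //; first exact: integrable_affine2.
  by move=> x _; rewrite lee_fin mul1r mul0r addr0 expR_ge1Dx.
have z01 : z0 <= 2^-1 by lra.
split.
  by move: z01; rewrite /z0 /mu ler_pdivrMr ?mulr_gt0 ?exprn_gt0//; lra.
move=> th1.
have pt x : expR (th * ((Y x ^+ 2 - q) / (4 * rho ^+ 2))) <=
    (1 - th * z0) + th * Z x + (16 * th ^+ 2) * expR (Z x).
  have -> : (Y x ^+ 2 - q) / (4 * rho ^+ 2) = Z x - z0 by rewrite -/mu mulrBl.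
  set w := Z x - z0; apply: (le_trans (expR_le_quadratic _)).
  suff : (th * w) ^+ 2 * expR `|th * w| <= 16 * th ^+ 2 * expR (Z x).
    by rewrite /w; lra.
  have e1 : expR `|th * w| <= expR (`|w| / 2).
    by rewrite ler_expR normrM mulrC ler_wpM2l.
  have e2 : w ^+ 2 * expR (`|w| / 2) <= 16 * expR (Z x).
    have [w0|w0] := leP 0 w.
      rewrite ger0_norm//; have := sqr_expR_le w0.
      have e3 : expR (w / 2) * expR (w / 2) <= expR (Z x).
        by rewrite -expRD ler_expR /w; lra.
      by have := expR_ge0 (w / 2); nra.
    have w1 : - 2^-1 <= w by rewrite /w; have := Z0 x; lra.
    have e3 : expR (`|w| / 2) <= 2.
      rewrite ltr0_norm//; apply: (@le_trans _ _ (expR 4^-1)); first by rewrite ler_expR; lra.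
      have := expRxMexpNx_1 (4^-1 : R); have := expR_ge1Dx (- 4^-1 : R).
      have := expR_ge0 (4^-1 : R); nra.
    have e4 : 1 <= expR (Z x) by rewrite -[leLHS]expR0 ler_expR.
    have := expR_ge0 (`|w| / 2); nra.
  apply: (@le_trans _ _ (th ^+ 2 * (w ^+ 2 * expR (`|w| / 2)))).
    by rewrite exprMn -mulrA !ler_wpM2l ?sqr_ge0.
  rewrite [leRHS](_ : _ = th ^+ 2 * (16 * expR (Z x))); last by ring.
  by rewrite ler_wpM2l ?sqr_ge0.
apply: (@le_trans _ _ (1 - th * z0 + th * z0 + (16 * th ^+ 2) * m)%:E).
  rewrite -(integral_affine2 (1 - th * z0) th (16 * th ^+ 2) iZ ieZ ZE mE).
  apply: ge0_le_integral => //.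
  - apply/measurable_EFinP/measurableT_comp => //; apply: measurable_funM => //.
    apply: measurable_funM => //; apply: measurable_funB => //.
    exact: measurable_funX.
  - by apply: (measurable_int p); exact: integrable_affine2.
  - by move=> x _; rewrite lee_fin.
rewrite lee_fin; apply: le_trans (expR_ge1Dx _).
by have := sqr_ge0 th; nra.
Qed.

End subexponential.

Section second_moments.
Context {R : realType} (d : nat).
Variable p : probability (d.-tuple R) R.
Hypothesis p2 : has_second_moments p.
Local Notation Sigma := (second_moment p).

Lemma linE (w : 'cV[R]_d) x : (w^T *m vec x) ord0 ord0 = \sum_i w i ord0 * tnth x i.
Proof. by rewrite mxE; apply: eq_bigr => i _; rewrite !mxE. Qed.

Lemma measurable_lin (w : 'cV[R]_d) :
  measurable_fun [set: d.-tuple R] (fun x => (w^T *m vec x) ord0 ord0).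
Proof.
rewrite (_ : (fun x => _) = (fun x => \sum_i w i ord0 * tnth x i)); last first.
  by apply/funext => x; exact: linE.
by apply: measurable_sum => i; apply: measurable_funM => //; exact: measurable_tnth.
Qed.

Lemma lin_sqrE (w : 'cV[R]_d) x : ((w^T *m vec x) ord0 ord0 ^+ 2)%:E =
  (\sum_i \sum_j (w i ord0 * w j ord0)%:E * (tnth x i * tnth x j)%:E)%E.
Proof.
rewrite linE expr2 big_distrl/= -sumEFin; apply: eq_bigr => i _.
by rewrite big_distrr/= -sumEFin; apply: eq_bigr => j _; rewrite -EFinM; congr EFin; ring.
Qed.

Lemma integrable_lin_sqr (w : 'cV[R]_d) :
  p.-integrable setT (fun x => ((w^T *m vec x) ord0 ord0 ^+ 2)%:E).
Proof.
rewrite (_ : (fun x => _) = (fun x => \sum_i \sum_j (w i ord0 * w j ord0)%:E *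
    (tnth x i * tnth x j)%:E)%E); last by apply/funext => x; exact: lin_sqrE.
apply: integrable_sum => // i _; apply: integrable_sum => // j _.
exact: integrableZl.
Qed.

Lemma integral_lin_sqr (w : 'cV[R]_d) :
  (\int[p]_x ((w^T *m vec x) ord0 ord0 ^+ 2)%:E = (qform Sigma w)%:E)%E.
Proof.
under eq_integral do rewrite lin_sqrE.
rewrite integral_sum//; last first.
  by move=> i; apply: integrable_sum => // j _; exact: integrableZl.
rewrite qform_expand -sumEFin; apply: eq_bigr => i _.
rewrite integral_sum//; last by move=> j; exact: integrableZl.
rewrite -sumEFin; apply: eq_bigr => j _.
rewrite integralZl// [RHS]EFinM [RHS]muleC mxE fineK//.
exact: integrable_fin_num.
Qed.

Lemma psd_second_moment : psd Sigma.
Proof.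
split=> [|u].
  apply/matrixP => i j; rewrite !mxE; congr fine; apply: eq_integral => x _.
  by rewrite mulrC.
by rewrite -lee_fin -integral_lin_sqr integral_ge0// => x _; rewrite lee_fin sqr_ge0.
Qed.

Lemma integrable_coord i : p.-integrable setT (fun x => (tnth x i)%:E).
Proof.
apply: (@le_integrable _ _ _ p setT _ (fun x => (tnth x i)%:E)
  (fun x => (1 + 0 * (tnth x i * tnth x i) + 1 * (tnth x i * tnth x i))%:E)) => //.
- by apply/measurable_EFinP; exact: measurable_tnth.
- move=> x _; rewrite !abse_EFin lee_fin mul0r addr0 mul1r -expr2 [leRHS]ger0_norm; last first.
    by rewrite addr_ge0 ?sqr_ge0.
  by rewrite -(real_normK (num_real (tnth x i))); have := normr_ge0 (tnth x i); nra.
- by apply: integrable_affine2; exact: p2.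
Qed.

Hypothesis p0 : mean_zero p.

Lemma integral_lin (w : 'cV[R]_d) : (\int[p]_x ((w^T *m vec x) ord0 ord0)%:E = 0)%E.
Proof.
transitivity (\int[p]_x \sum_i ((w i ord0)%:E * (tnth x i)%:E))%E.
  apply: eq_integral => x _; rewrite linE -sumEFin.
  by apply: eq_bigr => i _; rewrite EFinM.
rewrite integral_sum//; last by move=> i; apply: integrableZl => //; exact: integrable_coord.
rewrite big1// => i _; rewrite integralZl// ?p0 ?mule0//; exact: integrable_coord.
Qed.

Local Notation M := (psd_sqrt Sigma).
Local Notation W := (mp_pinv M).

Lemma subgaussian_lin (rho : R) (v : 'cV[R]_d) (s : R) : subgaussian p rho ->
  qform 1%:M v <= 1 ->
  (\int[p]_x (expR (s * ((W^T *m v)^T *m vec x) ord0 ord0))%:E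
    <= (expR (s ^+ 2 * rho ^+ 2 / 2))%:E)%E.
Proof.
rewrite /subgaussian /=; set m := \col_i _ => sp v1.
have m0 : m = 0.
  apply/colP => i; rewrite !mxE.
  rewrite (_ : (\int[p]_x _)%E = 0%E)//.
  rewrite -[RHS](integral_lin (row i W)^T); apply: eq_integral => x _.
  by rewrite trmxK -row_mul !mxE.
have [v0|v0] := eqVneq v 0.
  rewrite v0 mulmx0 trmx0; under eq_integral do rewrite mul0mx mxE mulr0 expR0.
  rewrite integral_cst// [X in (_ * X)%E](probability_setT p) mule1 lee_fin.
  by rewrite -[leLHS]expR0 ler_expR divr_ge0// mulr_ge0 ?sqr_ge0.
pose a := Num.sqrt (qform 1%:M v).
have q0 := qform1_gt0 v0.
have a0 : 0 < a by rewrite sqrtr_gt0.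
have a2 : a ^+ 2 = qform 1%:M v by rewrite sqr_sqrtr// ltW.
have := sp (a^-1 *: v) _ (s * a); rewrite -qform1 qform_scalev exprVn a2.
rewrite mulVf ?gt_eqF// => /(_ erefl) h.
apply: (le_trans (le_trans _ h)).
  rewrite le_eqVlt; apply/orP; left; apply/eqP; apply: eq_integral => x _.
  congr ((expR _)%:E); rewrite m0 subr0 [(_ *: _)^T]linearZ/= -scalemxAl [in RHS]mxE.
  rewrite -mulrA mulVKf ?gt_eqF//; congr (_ * _).
  by rewrite trmx_mul trmxK mulmxA.
rewrite lee_fin ler_expR ler_pM2r ?invr_gt0// ler_wpM2r ?sqr_ge0//.
by rewrite exprMn a2 ler_piMr ?sqr_ge0.
Qed.

Lemma whiteningP : [/\ M^T = M, M *m M = Sigma, M *m W *m M = M,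
  (M *m W)^T = M *m W & (W *m M)^T = W *m M].
Proof.
have [[sM _] MM] := psd_sqrtP psd_second_moment.
by have [h1 [_ [h2 h3]]] := mp_pinvP M; split.
Qed.

Lemma range_second_moment :
  exists2 A : set (d.-tuple R), measurable A &
    (\int[p]_x (\1_A x : R)%:E = 1)%E /\ forall x, A x -> M *m W *m vec x = vec x.
Proof.
have [sM MM MWM sMW sWM] := whiteningP.
pose w i := (row i (1%:M - M *m W))^T.
pose h x : R := \sum_i ((w i)^T *m vec x) ord0 ord0 ^+ 2.
have mh : measurable_fun [set: d.-tuple R] h.
  by apply: measurable_sum => i; apply: measurable_funX; exact: measurable_lin.
have h0 x : 0 <= h x by apply: sumr_ge0 => i _; rewrite sqr_ge0.
have inth : (\int[p]_x `|(h x)%:E| = 0)%E.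
  under eq_integral do rewrite gee0_abs ?lee_fin// -sumEFin.
  rewrite ge0_integral_sum//=; last 2 first.
  - move=> i; apply/measurable_EFinP/measurable_funX; exact: measurable_lin.
  - by move=> i x _; rewrite lee_fin sqr_ge0.
  rewrite big1// => i _; rewrite integral_lin_sqr -MM -{1}sM qform_gram.
  have Mw : M *m w i = 0.
    rewrite -[LHS]trmxK trmx_mul trmxK sM -row_mul mulmxBl mul1mx MWM subrr.
    by rewrite row0 trmx0.
  by rewrite big1// => j _; rewrite Mw mxE expr0n.
pose A := [set x | h x = 0].
have mA : measurable A.
  have := mh measurableT [set 0] (measurable_set1 _); rewrite setTI; exact.
exists A => //; split.
  have ae : ae_eq p setT (fun x => (h x)%:E) (cst 0%E).
    by apply/ae_eq_integral_abs => //; exact/measurable_EFinP.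
  transitivity (\int[p]_x (cst 1%E x : \bar R))%E; last first.
    by rewrite integral_cst// [X in (_ * X)%E](probability_setT p) mule1.
  apply: ge0_ae_eq_integral => //.
    by apply/measurable_EFinP; exact: measurable_indic.
  apply: filterS ae => x /= hx _; rewrite indicE mem_set//=.
  by have := hx Logic.I => -[].
move=> x /= hx0; apply/eqP; rewrite -subr_eq0 -opprB oppr_eq0; apply/eqP/colP => i.
move/eqP : hx0; rewrite psumr_eq0; last by move=> j _; rewrite sqr_ge0.
move=> /allP/(_ i (mem_index_enum i)); rewrite /= sqrf_eq0 /w trmxK -row_mul => /eqP.
by rewrite mulmxBl mul1mx mxE => hi; rewrite [RHS]mxE; exact: hi.
Qed.

Lemma subgaussian_param_ge (rho : R) : (0 < d)%N -> 0 < rho ->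
  subgaussian p rho -> Sigma \in unitmx -> 1 <= 2 * rho ^+ 2.
Proof.
move=> d0 rho0 sp uS; have [sM MM MWM sMW sWM] := whiteningP.
have uM : M \in unitmx.
  by move: uS; rewrite -{1}MM unitmx_mul => /andP[].
have WM : W *m M = 1%:M.
  by apply: (can_inj (mulKmx uM)); rewrite mulmxA MWM mulmx1.
pose v : 'cV[R]_d := delta_mx (Ordinal d0) ord0.
have v1 : qform 1%:M v = 1.
  rewrite qform1 (bigD1 (Ordinal d0))//= mxE !eqxx expr1n big1 ?addr0// => i i0.
  by rewrite mxE (negbTE i0) expr0n.
have mY := measurable_lin (W^T *m v).
have [+ _] := @subexponential_sqr R _ _ p rho (qform Sigma (W^T *m v)) 0
  (fun x => ((W^T *m v)^T *m vec x) ord0 ord0) rho0 mY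
  (fun s => subgaussian_lin s sp (eq_ind_r (fun y => y <= 1) (lexx _) v1))
  (integrable_lin_sqr _) (integral_lin_sqr _).
have WSW : W *m Sigma *m W^T = W *m M *m (W *m M)^T.
  by rewrite trmx_mul sM !mulmxA -(mulmxA W M M) MM.
by rewrite qform_mulmx trmxK WSW WM trmx1 mulmx1 v1.
Qed.

Section concentration.
Variables (n : nat) (rho delta : R).
Hypotheses (d0 : (0 < d)%N) (n0 : (0 < n)%N) (rho0 : 0 < rho).
Hypothesis delta01 : 0 < delta < 1.
Hypothesis sp : subgaussian p rho.
Hypothesis rho1 : 1 <= 2 * rho ^+ 2.
Local Notation D := (d%:R + ln delta^-1).
Hypothesis nD : 16 * (rho ^+ 4 * D) <= n%:R.

Let eta := Num.sqrt (D / n%:R).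

Let D_gt0 : 0 < D.
Proof.
have /andP[e0 e1] := delta01.
by rewrite ltr_wpDr ?ltr0n// ln_ge0// invf_ge1// ltW.
Qed.

Let nR_gt0 : 0 < n%:R :> R. Proof. by rewrite ltr0n. Qed.

Let eta2 : n%:R * eta ^+ 2 = D.
Proof. by rewrite sqr_sqrtr ?divr_ge0 ?ltW// mulrC divfK ?gt_eqF. Qed.

Let eta_ge0 : 0 <= eta. Proof. exact: sqrtr_ge0. Qed.

Let eta_le : eta <= 2^-1.
Proof.
rewrite -(@ler_pXn2r _ 2)// ?nnegrE// -(ler_pM2l nR_gt0) eta2.
have r4E : rho ^+ 4 = rho ^+ 2 * rho ^+ 2 by rewrite -expr2 -exprM.
have r4 : 0 <= 4 * rho ^+ 4 - 1.
  by rewrite r4E; move: rho1; set r := rho ^+ 2 => r1; nra.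
by have := mulr_ge0 (ltW D_gt0) r4; move: nD; lra.
Qed.

Let Y (f : net_index d) x := ((W^T *m net_point f)^T *m vec x) ord0 ord0.
Let q (f : net_index d) := qform Sigma (W^T *m net_point f).
(* In the exponent, [52 = 32 + 20]: [32] absorbs the moment bound of
   [subexponential_sqr] and [20] pays for the [2 ^ (18 d)] points of the net;
   the threshold [t] below is [208 = 4 * 52] times [rho ^ 2 eta]. *)
Let k (b : bool) (f : net_index d) x :=
  expR ((-1) ^+ b * eta * ((Y f x ^+ 2 - q f) / (4 * rho ^+ 2))).
Let g (b : bool) (f : net_index d) (X : n.-tuple (d.-tuple R)) :=
  expR (- (52 * D)) * \prod_i k b f (tnth X i).

Let measurable_k b f : measurable_fun [set: d.-tuple R] (k b f).
Proof.
apply: measurableT_comp => //; apply: measurable_funM => //.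
apply: measurable_funM => //; apply: measurable_funB => //.
by apply: measurable_funX; exact: measurable_lin.
Qed.

Let measurable_g b f : measurable_fun [set: n.-tuple (d.-tuple R)] (g b f).
Proof.
apply: measurable_funM => //; apply: measurable_prod => i _.
exact: (measurableT_comp (measurable_k b f) (measurable_tnth i)).
Qed.

Let g_ge0 b f X : 0 <= g b f X.
Proof. by rewrite mulr_ge0 ?expR_ge0//; apply: prodr_ge0 => i _; exact: expR_ge0. Qed.

Let iter_int_g b f : in_net f ->
  (iter_int p (fun X => (g b f X)%:E) <= (expR (- (20 * D)))%:E)%E.
Proof.
move=> fN; have v1 := @qform1_net_point R d f d0 fN.
have [_ /(_ _) kle] := @subexponential_sqr R _ _ p rho (q f) ((-1) ^+ b * eta) (Y f) rho0
  (measurable_lin _) (fun s => subgaussian_lin s sp v1)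
  (integrable_lin_sqr _) (integral_lin_sqr _).
have {}kle : (\int[p]_x (k b f x)%:E <= (expR (32 * eta ^+ 2))%:E)%E.
  have := kle _; rewrite exprMn sqrr_sign mul1r; apply.
  by rewrite normrM normr_sign mul1r ger0_norm.
have k0 x : 0 <= k b f x by exact: expR_ge0.
have kfin : (\int[p]_x (k b f x)%:E)%E \is a fin_num.
  rewrite ge0_fin_numE; first by rewrite (le_lt_trans kle)// ltry.
  by apply: integral_ge0 => x _; rewrite lee_fin.
pose m := fine (\int[p]_x (k b f x)%:E)%E.
have mE : (\int[p]_x (k b f x)%:E = m%:E)%E by rewrite fineK.
rewrite (iter_int_prod _ k0 (expR_ge0 _) (measurable_k b f) mE) lee_fin.
have m1 : m <= expR (32 * eta ^+ 2) by rewrite -lee_fin -mE.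
have m0 : 0 <= m by rewrite -lee_fin -mE integral_ge0// => x _; rewrite lee_fin.
apply: (@le_trans _ _ (expR (- (52 * D)) * expR (32 * eta ^+ 2) ^+ n)).
  by rewrite ler_wpM2l ?expR_ge0// lerXn2r ?nnegrE ?expR_ge0.
rewrite -expRM_natl -expRD ler_expR.
have -> : n%:R * (32 * eta ^+ 2) = 32 * (n%:R * eta ^+ 2) by ring.
by rewrite eta2; lra.
Qed.

Let s := enum [pred f : net_index d | in_net f].

Let t := 208 * rho ^+ 2 * eta.

Let dev f (X : n.-tuple (d.-tuple R)) := n%:R^-1 * \sum_i (Y f (tnth X i) ^+ 2 - q f).

Let g_ge1 f X : t < `|dev f X| -> 1 <= g true f X + g false f X.
Proof.
move=> tX.
have gE (b : bool) : g b f X = expR ((-1) ^+ b * eta * (n%:R * dev f X / (4 * rho ^+ 2)) - 52 * D).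
  rewrite /g -expR_sum -expRD; congr expR; rewrite addrC; congr (_ - _).
  by rewrite -mulr_sumr -mulr_suml /dev mulVKf ?gt_eqF.
have r2 : 0 < 4 * rho ^+ 2 by rewrite mulr_gt0// exprn_gt0.
have key (b : bool) : t < (-1) ^+ b * dev f X -> 1 <= g b f X.
  move=> tb; rewrite gE -[leLHS]expR0 ler_expR subr_ge0.
  rewrite [leRHS](_ : _ = eta * n%:R * ((-1) ^+ b * dev f X) / (4 * rho ^+ 2)); last first.
    by rewrite !mulrA; congr (_ / _); ring.
  rewrite ler_pdivlMr// -eta2.
  apply: (@le_trans _ _ (eta * n%:R * t)); first by rewrite /t; lra.
  by rewrite ler_wpM2l ?mulr_ge0// ltW.
have [X0|X0] := leP 0 (dev f X).
  have := key false; rewrite expr0 mul1r -(ger0_norm X0) => /(_ tX).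
  by have := g_ge0 true f X; lra.
have := key true; rewrite expr1 mulN1r -(ltr0_norm X0) => /(_ tX).
by have := g_ge0 false f X; lra.
Qed.

Let union_bound : (\sum_(f <- s) iter_int p (fun X => (g true f X)%:E + (g false f X)%:E)
  <= (delta / 2)%:E)%E.
Proof.
have /andP[e0 e1] := delta01.
apply: (@le_trans _ _ (\sum_(f <- s) (2 * expR (- (20 * D)))%:E)%E).
  rewrite big_seq [leRHS]big_seq; apply: lee_sum => f; rewrite mem_enum => fN.
  rewrite iter_intD//; try by move=> X; rewrite lee_fin g_ge0.
  - by rewrite mulrDl mul1r EFinD leeD// iter_int_g.
  - exact/measurable_EFinP.
  - exact/measurable_EFinP.
rewrite sumEFin lee_fin big_const_seq count_predT iter_addr_0 -cardE.
rewrite -[leLHS]mulr_natl.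
have cN := @card_net_le R d.
have e20 : expR (- (20 * D)) <= expR (- 20) ^+ d * delta.
  rewrite -expRM_natl mulrDr opprD expRD -mulr_natr; apply: ler_pM; rewrite ?expR_ge0//.
    by rewrite ler_expR; lra.
  rewrite lnV ?posrE// -[leRHS](lnK e0) ler_expR.
  have : ln delta <= 0 by rewrite ln_le0// ltW.
  lra.
have ex : expR (- 20) <= 2^-1 ^+ 20 :> R.
  have -> : (- 20 : R) = 20%:R * -1 by lra.
  rewrite expRM_natl lerXn2r ?nnegrE ?expR_ge0// expRN.
  rewrite lef_pV2 ?posrE ?expR_gt0//; have := expR_ge1Dx (1 : R); lra.
have h : expR (- 20) ^+ d <= 2^-1 ^+ (20 * d) :> R.
  by rewrite exprM lerXn2r ?nnegrE ?expR_ge0.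
have -> : delta / 2 = 2 ^+ (18 * d) * (2 * (2^-1 ^+ (18 * d) * 2^-1 ^+ 2 * delta)).
  rewrite (_ : 2 ^+ (18 * d) * _ =
    (2 ^+ (18 * d) * 2^-1 ^+ (18 * d)) * (2 * 2^-1 ^+ 2) * delta); last by ring.
  by rewrite exprVn divff ?expf_neq0//; field.
apply: ler_pM; rewrite ?mulr_ge0 ?expR_ge0//.
rewrite ler_pM2l//; apply: (le_trans e20); rewrite ler_pM2r//; apply: (le_trans h).
rewrite -exprD ler_wiXn2l//; try lra.
by rewrite (mulnDl 18 2) leq_add2l leq_pmulr.
Qed.

Lemma sample_cov_concentration :
  exists2 E : set (n.-tuple (d.-tuple R)), measurable E &
    ((1 - delta / 2)%:E <= iter_int p (fun X => (\1_E X : R)%:E))%E /\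
    forall X, E X -> forall u,
      `|qform (sample_cov X) u - qform Sigma u| <=
        416 * Num.sqrt (rho ^+ 4 * D / n%:R) * qform Sigma u.
Proof.
have [A mA [intA Arange]] := range_second_moment.
have [sM MM MWM sMW sWM] := whiteningP.
pose B f := [set X | `|dev f X| <= t].
pose C i : set (n.-tuple (d.-tuple R)) := [set X | A (tnth X i)].
pose E := (\bigcap_(f in [set` s]) B f) `&` (\bigcap_(i in [set` enum 'I_n]) C i).
have mB f : measurable (B f).
  have mdev : measurable_fun [set: n.-tuple (d.-tuple R)] (fun X => `|dev f X|).
    apply: measurableT_comp => //; apply: measurable_funM => //.
    apply: measurable_sum => i; apply: measurable_funB => //; apply: measurable_funX.
    exact: (measurableT_comp (measurable_lin _) (measurable_tnth i)).
  have := mdev measurableT `]-oo, t]%classic (measurable_itv _); rewrite setTI.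
  by rewrite (_ : _ @^-1` _ = B f).
have mC i : measurable (C i).
  by have := @measurable_tnth _ (d.-tuple R) n i measurableT A mA; rewrite setTI.
have mE : measurable E.
  apply: measurableI; rewrite bigcap_seq; exact: bigsetI_measurable.
exists E => //; split.
- have mIA : measurable_fun [set: d.-tuple R] (\1_A : d.-tuple R -> R).
    exact: measurable_indic.
  have IA0 x : 0 <= \1_A x :> R by rewrite indicE ler0n.
  have hA := @iter_int_prod R _ _ p n (\1_A) 1 1 IA0 ler01 mIA intA.
  rewrite expr1n mulr1 in hA.
  have pt X : ((1 * \prod_i \1_A (tnth X i))%:E <= (\1_E X : R)%:E +
      \sum_(f <- s) ((g true f X)%:E + (g false f X)%:E))%E.
    have sum_ge0 : (0 <= \sum_(f <- s) ((g true f X)%:E + (g false f X)%:E))%E.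
      by apply: sume_ge0 => f _; rewrite -EFinD lee_fin addr_ge0 ?g_ge0.
    have prod_le1 : \prod_i (\1_A (tnth X i) : R) <= 1.
      by apply: prodr_ile1 => i _; rewrite indicE ler0n/= lern1 leq_b1.
    have [XE|XE] := pselect (E X).
      rewrite indicE mem_set// mul1r; apply: (@le_trans _ _ 1%:E); first by rewrite lee_fin.
      by rewrite leeDl.
    rewrite mul1r (@indicE _ _ E) memNset// add0e.
    have [XC|XC] := pselect (forall i, A (tnth X i)); last first.
      move/existsNP : XC => [i Xi].
      by rewrite (bigD1 i)//= indicE memNset// mul0r.
    have : ~ (forall f, f \in s -> B f X).
      by move=> XB; apply: XE; split => [f /= /XB|i _] //; exact: XC.
    move=> /existsNP[f /not_implyP[fs /negP]]; rewrite -ltNge => /g_ge1 g1.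
    apply: (@le_trans _ _ 1%:E); first by rewrite lee_fin.
    rewrite (big_rem f fs)/= -[leLHS]adde0 leeD//; last first.
      by apply: sume_ge0 => f' _; rewrite -EFinD lee_fin addr_ge0 ?g_ge0.
  have mg f : measurable_fun [set: n.-tuple (d.-tuple R)]
      (fun X => (g true f X)%:E + (g false f X)%:E)%E.
    by apply: emeasurable_funD; exact/measurable_EFinP.
  have gg0 f X : (0 <= (g true f X)%:E + (g false f X)%:E)%E.
    by rewrite -EFinD lee_fin addr_ge0 ?g_ge0.
  have mE1 : measurable_fun [set: n.-tuple (d.-tuple R)] (fun X => (\1_E X : R)%:E).
    by apply/measurable_EFinP; exact: measurable_indic.
  rewrite EFinB leeBlDr// -hA.
  apply: (@le_trans _ _ (iter_int p (fun X => (\1_E X : R)%:E +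
      \sum_(f <- s) ((g true f X)%:E + (g false f X)%:E)))%E).
    apply: le_iter_int => //.
    + by move=> X; rewrite lee_fin mul1r; apply: prodr_ge0 => i _.
    + apply/measurable_EFinP/measurable_funM => //; apply: measurable_prod => i _.
      exact: (measurableT_comp mIA (measurable_tnth i)).
    + by apply: emeasurable_funD => //; exact: emeasurable_sum.
  rewrite iter_intD//; last 2 first.
  + by move=> X; exact: sume_ge0.
  + exact: emeasurable_sum.
  rewrite leeD2l// iter_int_sum//; exact: union_bound.
- move=> X [XB XC] u.
  have Xrange i : M *m W *m vec (tnth X i) = vec (tnth X i).
    by apply: Arange; apply: (XC i); rewrite /= mem_enum.
  pose Q := W *m sample_cov X *m W^T - W *m Sigma *m W^T.
  have sQ : Q^T = Q.
    have [sS _] := psd_second_moment.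
    by rewrite linearB/= !trmx_mul !trmxK trmx_sample_cov sS !mulmxA.
  have Qnet f : in_net f -> `|qform Q (net_point f)| <= t.
    move=> fN; have := XB f; rewrite /= mem_enum => /(_ fN); rewrite /B/=.
    rewrite /Q qformB !qform_conj.
    rewrite qform_sample_cov /dev sumrB sumr_const card_ord mulrBr.
    by rewrite -[q f *+ n]mulr_natl mulKf ?gt_eqF.
  have := qform_net_bound d0 sQ Qnet (M *m u).
  have WMu : W^T *m (M *m u) = M *m W *m u.
    by rewrite -sMW trmx_mul sM mulmxA.
  have MMW : M *m (M *m W) = M by have := congr1 trmx MWM; rewrite trmx_mul sMW sM.
  have qS w : qform Sigma w = qform 1%:M (M *m w) by rewrite qform_mulmx mulmx1 sM MM.
  rewrite /Q qformB !qform_conj WMu -qS.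
  have -> : qform (sample_cov X) (M *m W *m u) = qform (sample_cov X) u.
    rewrite !qform_sample_cov; congr (_ * _); apply: eq_bigr => i _; congr (_ ^+ 2).
    by rewrite trmx_mul sMW -mulmxA Xrange.
  have -> : qform Sigma (M *m W *m u) = qform Sigma u by rewrite !qS mulmxA MMW.
  move=> h; apply: (le_trans h); rewrite le_eqVlt; apply/orP; left; apply/eqP.
  congr (_ * _); rewrite /t.
  have -> : rho ^+ 4 * D / n%:R = (rho ^+ 2) ^+ 2 * (D / n%:R) by rewrite -exprM mulrA.
  rewrite sqrtrM ?sqr_ge0// sqrtr_sqr ger0_norm ?sqr_ge0// -/eta; ring.
Qed.

End concentration.

End second_moments.

(** * Bias-variance decomposition and comparison of the losses *)

Section losses.
Context {R : realType}.

Lemma vec_cons_mulmx (n d : nat) (N : 'M[R]_(d, n.+1)) x (z : n.-tuple R) :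
  N *m vec (cons_tuple x z) = x *: col ord0 N + col' ord0 N *m vec z.
Proof.
apply/colP => i; rewrite !mxE big_ord_recl !mxE tnth0 mulrC; congr (_ + _).
by apply: eq_bigr => j _; rewrite !mxE tnthS.
Qed.

Lemma iter_int_normal_qform (n d : nat) (sigma : R) (S : 'M[R]_d) (N : 'M[R]_(d, n)) u :
  0 < sigma -> S^T = S ->
  iter_int (normal_prob 0 sigma) (fun z : n.-tuple R => (qform S (u + N *m vec z))%:E) =
  (qform S u + sigma ^+ 2 * \tr (N^T *m S *m N))%:E.
Proof.
move=> sg0 sS; elim: n N u => [|n ih] N u.
  rewrite /= (_ : N *m _ = 0) ?addr0.
    by rewrite /mxtrace big_ord0 mulr0 addr0.
  by apply/colP => i; rewrite !mxE big_ord0.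
pose c := col ord0 N; pose N' := col' ord0 N.
pose K := qform S u + sigma ^+ 2 * \tr (N'^T *m S *m N').
transitivity (\int[normal_prob 0 sigma]_x
    (K + (2 * bform S u c) * x + qform S c * x ^+ 2)%:E)%E.
  apply: eq_integral => x _.
  transitivity (iter_int (normal_prob 0 sigma)
      (fun z : n.-tuple R => (qform S ((u + x *: c) + N' *m vec z))%:E)).
    by apply: eq_iter_int => z; rewrite vec_cons_mulmx addrA.
  rewrite ih; congr (_%:E); rewrite /K qformDv// qform_scalev (bformC u)// bformZl.
  by rewrite (bformC c u)//; ring.
rewrite (integral_affine2 (mu := normal_prob 0 sigma) K (2 * bform S u c) (qform S c)
  (integrable_normal_id sg0) (integrable_normal_sqr sg0)
  (integral_normal_id sg0) (integral_normal_sqr sg0)).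
congr (_%:E); rewrite mulr0 addr0 /K !mxtrace_conj_qform big_ord_recl -/c.
rewrite (eq_bigr (fun j => qform S (col (lift ord0 j) N))); last first.
  by move=> j _; congr qform; apply/colP => i; rewrite !mxE.
by ring.
Qed.

Lemma integral_dot_sqr (d : nat) (p : probability (d.-tuple R) R) (w : 'cV[R]_d) :
  has_second_moments p ->
  (\int[p]_x (((vec x)^T *m w) ord0 ord0 ^+ 2)%:E = (qform (second_moment p) w)%:E)%E.
Proof.
move=> p2; rewrite -integral_lin_sqr//; apply: eq_integral => x _.
congr ((_ ^+ 2)%:E); transitivity (((vec x)^T *m w)^T ord0 ord0); first by rewrite [RHS]mxE.
by rewrite trmx_mul trmxK.
Qed.

Definition noise_mx (d nS : nat) (XS : nS.-tuple (d.-tuple R)) (C : 'M[R]_d) : 'M[R]_(d, nS) :=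
  nS%:R^-1 *: (C *m invmx (sample_cov XS) *m (data_mx XS)^T).

Lemma noise_mx_gram (d nS : nat) (XS : nS.-tuple (d.-tuple R)) (C : 'M[R]_d) :
  sample_cov XS \in unitmx ->
  noise_mx XS C *m (noise_mx XS C)^T = nS%:R^-1 *: (C *m invmx (sample_cov XS) *m C^T).
Proof.
move=> uS; have sV : (invmx (sample_cov XS))^T = invmx (sample_cov XS).
  by rewrite trmx_inv trmx_sample_cov.
rewrite /noise_mx [(_ *: _)^T]linearZ/= -scalemxAl -scalemxAr; congr (_ *: _).
set V := invmx (sample_cov XS); set X := data_mx XS.
transitivity (C *m V *m (nS%:R^-1 *: (X^T *m X)) *m V *m C^T).
  by rewrite !trmx_mul trmxK sV -scalemxAr -!scalemxAl !mulmxA.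
by rewrite -/(sample_cov XS) mulmxKV.
Qed.

Lemma loss_SE (d nS : nat) (pT : probability (d.-tuple R) R) (sigma r : R)
    (XS : nS.-tuple (d.-tuple R)) (C : 'M[R]_d) :
  0 < sigma -> (0 < nS)%N -> has_second_moments pT -> sample_cov XS \in unitmx ->
  loss_S pT sigma r XS C = ereal_sup [set (qform (second_moment pT) ((C - 1) *m b) +
    sigma ^+ 2 / nS%:R *
      \tr (C *m invmx (sample_cov XS) *m C^T *m second_moment pT))%:E | b in ball2 r].
Proof.
move=> sg0 n0 p2 uS; congr ereal_sup; apply: eq_imagel => b _.
have [sT _] := psd_second_moment p2.
transitivity (iter_int (normal_prob 0 sigma) (fun z : nS.-tuple R =>
    (qform (second_moment pT) ((C - 1) *m b + noise_mx XS C *m vec z))%:E)).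
  apply: eq_iter_int => z; rewrite integral_dot_sqr//; congr ((qform _ _)%:E).
  rewrite /beta_hat mulmxDr scalerDr mulmxBl mul1mx addrAC; congr (_ - _ + _).
    rewrite -!mulmxA !mulmxA -(mulmxA _ (data_mx XS)^T) scalemxAl scalemxAr.
    by rewrite -/(sample_cov XS) mulmxKV.
  by rewrite /noise_mx -scalemxAl.
rewrite iter_int_normal_qform//; congr ((_ + _)%:E).
rewrite mxtrace_mulC mulmxA noise_mx_gram// -scalemxAl mxtraceZ mulrA.
by [].
Qed.

Lemma loss_RE (d nS : nat) (pS pT : probability (d.-tuple R) R) (sigma r : R)
    (A : 'M[R]_d) :
  0 < sigma -> (0 < nS)%N -> has_second_moments pT ->
  loss_R nS pS pT sigma r A = ereal_sup [set (qform (second_moment pT)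
      ((A *m psd_sqrt (second_moment pS) - 1) *m b) +
    sigma ^+ 2 / nS%:R * \tr (A^T *m second_moment pT *m A))%:E | b in ball2 r].
Proof.
move=> sg0 n0 p2; congr ereal_sup; apply: eq_imagel => b _.
have [sT _] := psd_second_moment p2.
have nR : 0 < nS%:R :> R by rewrite ltr0n.
transitivity (iter_int (normal_prob 0 (sigma / Num.sqrt nS%:R)) (fun z : d.-tuple R =>
    (qform (second_moment pT) ((A *m psd_sqrt (second_moment pS) - 1) *m b + A *m vec z))%:E)).
  apply: eq_iter_int => z; rewrite integral_dot_sqr//; congr ((qform _ _)%:E).
  by rewrite mulmxDr mulmxBl mul1mx mulmxA addrAC.
rewrite iter_int_normal_qform// ?divr_gt0 ?sqrtr_gt0//; congr ((_ + _ * _)%:E).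
by rewrite expr_div_n sqr_sqrtr// ltW.
Qed.

Lemma loss_R_ge0 (d nS : nat) (pS pT : probability (d.-tuple R) R) (sigma r : R)
    (A : 'M[R]_d) :
  0 < sigma -> (0 < nS)%N -> has_second_moments pT ->
  (0 <= loss_R nS pS pT sigma r A)%E.
Proof.
move=> sg0 n0 p2; rewrite loss_RE//; apply: le_ereal_sup_tmp; eexists.
  by exists 0 => //=; rewrite /ball2/= big1 ?sqr_ge0// => i _; rewrite mxE expr0n.
have [_ pT0] := psd_second_moment p2.
rewrite lee_fin addr_ge0// mulr_ge0 ?divr_ge0 ?sqr_ge0// mxtrace_conj_qform.
by apply: sumr_ge0.
Qed.

End losses.

Section deterministic.
Context {R : realType} (d nS nU : nat) (sigma r a b : R).
Variables (pS pT : probability (d.-tuple R) R).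
Variables (XS : nS.-tuple (d.-tuple R)) (XU : nU.-tuple (d.-tuple R)).
Hypotheses (d0 : (0 < d)%N) (nS0 : (0 < nS)%N).
Hypotheses (sigma0 : 0 < sigma) (r0 : 0 < r).
Hypotheses (pS2 : has_second_moments pS) (pT2 : has_second_moments pT).
Local Notation SigS := (second_moment pS).
Local Notation SigT := (second_moment pT).
Local Notation M := (psd_sqrt SigS).
Hypothesis uS : SigS \in unitmx.
Hypotheses (a0 : 0 <= a) (a1 : a <= 2^-1) (b0 : 0 <= b) (b1 : b <= 2^-1).
Hypothesis hS : forall u, `|qform (sample_cov XS) u - qform SigS u| <= a * qform SigS u.
Hypothesis hU : forall u, `|qform (sample_cov XU) u - qform SigT u| <= b * qform SigT u.

Let a1' : 0 < 1 - a. Proof. by move: a1; lra. Qed.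

Let b1' : 0 < 1 - b. Proof. by move: b1; lra. Qed.

Let hS1 u : (1 - a) * qform SigS u <= qform (sample_cov XS) u.
Proof. by have := hS u; rewrite ler_norml => /andP[]; lra. Qed.

Let hU1 u : (1 - b) * qform SigT u <= qform (sample_cov XU) u.
Proof. by have := hU u; rewrite ler_norml => /andP[]; lra. Qed.

Let hU2 u : qform (sample_cov XU) u <= (1 + b) * qform SigT u.
Proof. by have := hU u; rewrite ler_norml => /andP[]; lra. Qed.

Let MM : M *m M = SigS. Proof. by have [_ ] := psd_sqrtP (psd_second_moment pS2). Qed.

Let sM : M^T = M. Proof. by have [[] ] := psd_sqrtP (psd_second_moment pS2). Qed.

Let uM : M \in unitmx.
Proof. by move: uS; rewrite -{1}MM unitmx_mul => /andP[]. Qed.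

Lemma sample_cov_unitmx : sample_cov XS \in unitmx.
Proof.
apply: qform_gt0_unitmx => u u0; apply: lt_le_trans (hS1 u).
rewrite mulr_gt0//.
have -> : qform SigS u = qform 1%:M (M *m u) by rewrite qform_mulmx mulmx1 sM MM.
apply: qform1_gt0; apply: contra_neq u0 => Mu.
by rewrite -(mulKmx uM u) Mu mulmx0.
Qed.

Let inv_le : loewner_le (invmx (sample_cov XS)) ((1 - a)^-1 *: invmx SigS).
Proof.
have a1n : 1 - a != 0 by rewrite gt_eqF.
have [sS pS0] := psd_second_moment pS2.
rewrite -invmxZ ?unitmxZ ?unitfE//; apply: loewner_le_invmx.
- by rewrite linearZ/= sS.
- exact: trmx_sample_cov.
- by rewrite unitmxZ ?unitfE.
- exact: sample_cov_unitmx.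
- by move=> u; rewrite qformZ mulr_ge0// ltW.
- by move=> u; rewrite qformZ.
Qed.

Lemma loss_S_le_obj (C : 'M[R]_d) (tau : R) : prog_feas (sample_cov XU) C tau ->
  (loss_S pT sigma r XS C <=
    ((1 - b)^-1 * @prog_obj R d nS r sigma (sample_cov XS) (sample_cov XU) C tau)%:E)%E.
Proof.
move=> feas; have uhS := sample_cov_unitmx.
rewrite loss_SE//; apply: ge_ereal_sup => _ [u /= ur <-]; rewrite lee_fin.
rewrite ler_pdivlMl// /prog_obj mulrDr.
have tau0 : 0 <= tau.
  have := feas (delta_mx (Ordinal d0) ord0).
  rewrite -qform_mulmx qform_scalar => h.
  have q1 : 0 < qform 1%:M (delta_mx (Ordinal d0) ord0 : 'cV[R]_d).
    apply: qform1_gt0; apply/negP => /eqP/colP/(_ (Ordinal d0)).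
    by rewrite !mxE !eqxx => /eqP; rewrite oner_eq0.
  by have := le_trans (qform_sample_cov_ge0 _ _) h; rewrite pmulr_lge0.
apply: lerD.
  apply: le_trans (hU1 _) _; rewrite qform_mulmx; apply: le_trans (feas u) _.
  by rewrite qform_scalar mulrC ler_wpM2r// qform1.
rewrite mulrCA ler_wpM2l ?divr_ge0 ?sqr_ge0//.
have nE : C *m invmx (sample_cov XS) *m C^T = nS%:R *: (noise_mx XS C *m (noise_mx XS C)^T).
  by rewrite noise_mx_gram// scalerA divff ?scale1r// pnatr_eq0 -lt0n.
move: (noise_mx XS C) nE => N ->; rewrite -!scalemxAl !mxtraceZ mulrCA ler_wpM2l//.
rewrite -!(mulmxA N) !(mxtrace_mulC N).
rewrite -mxtraceZ scalemxAl scalemxAr; apply: loewner_le_mxtrace => v.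
by rewrite qformZ.
Qed.

Lemma obj_le_loss_R (A : 'M[R]_d) (l : R) : loss_R nS pS pT sigma r A = l%:E ->
  exists2 tau, prog_feas (sample_cov XU) (A *m M) tau &
    @prog_obj R d nS r sigma (sample_cov XS) (sample_cov XU) (A *m M) tau <=
      (1 + b) / (1 - a) * l.
Proof.
rewrite loss_RE// => lE; set V := sigma ^+ 2 / nS%:R * _ in lE.
have ub (u : 'cV[R]_d) : ball2 r u -> qform SigT ((A *m M - 1) *m u) + V <= l.
  by move=> ru; rewrite -lee_fin -lE; apply: ereal_sup_ubound; exists u.
have V0 : 0 <= V.
  rewrite mulr_ge0 ?divr_ge0 ?sqr_ge0// mxtrace_conj_qform; apply: sumr_ge0 => j _.
  by have [_] := psd_second_moment pT2.
have lV : 0 <= l - V.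
  have := ub 0; rewrite mulmx0 /qform !mulmx0 mxE add0r subr_ge0; apply.
  by rewrite /ball2/= big1 ?sqr_ge0// => i _; rewrite mxE expr0n.
pose tau0 := (l - V) / r ^+ 2.
have r2 : 0 < r ^+ 2 by rewrite exprn_gt0.
have tau00 : 0 <= tau0 by rewrite divr_ge0// ltW.
have feas u : qform SigT ((A *m M - 1) *m u) <= tau0 * qform 1%:M u.
  have [->|u0] := eqVneq u 0; first by rewrite mulmx0 /qform !mulmx0 mxE mulr0.
  have q0 := qform1_gt0 u0.
  pose c := r / Num.sqrt (qform 1%:M u).
  have c2 : c ^+ 2 = r ^+ 2 / qform 1%:M u by rewrite expr_div_n sqr_sqrtr// ltW.
  have := ub (c *: u); rewrite -scalemxAr qform_scalev c2 => h.
  have {}h : r ^+ 2 / qform 1%:M u * qform SigT ((A *m M - 1) *m u) + V <= l.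
    by apply: h; rewrite /ball2/= -qform1 qform_scalev c2 divfK ?gt_eqF.
  rewrite /tau0 mulrAC ler_pdivlMr// -ler_pdivrMr//.
  by rewrite -mulrA mulrC lerBrDr.
exists ((1 + b) * tau0).
  move=> u; rewrite -qform_mulmx qform_scalar; apply: (le_trans (hU2 _)).
  by rewrite -mulrA ler_wpM2l// addr_ge0.
rewrite /prog_obj.
set C := A *m M.
have CC : C *m invmx SigS *m C^T = A *m A^T.
  have SM : invmx SigS *m M = invmx M.
    by apply: (can_inj (mulmxK uM)); rewrite -mulmxA MM !mulVmx.
  by rewrite /C trmx_mul sM -!mulmxA (mulmxA (invmx SigS)) SM (mulmxA M) mulmxV// mul1mx.
have tr1 : \tr (C *m invmx (sample_cov XS) *m C^T *m sample_cov XU) <=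
    (1 - a)^-1 * \tr (A *m A^T *m sample_cov XU).
  rewrite -CC ![sample_cov XU]/sample_cov -!scalemxAr !mxtraceZ mulrCA ler_wpM2l ?invr_ge0//.
  pose T := C^T *m (data_mx XU)^T.
  have trT (N : 'M[R]_d) : \tr (C *m N *m C^T *m ((data_mx XU)^T *m data_mx XU)) =
      \tr (T^T *m N *m T).
    have TT : T^T = data_mx XU *m C by rewrite /T [LHS]trmx_mul !trmxK.
    by rewrite TT /T !mulmxA [LHS]mxtrace_mulC !mulmxA.
  by rewrite !trT -mxtraceZ scalemxAl scalemxAr loewner_le_mxtrace.
have tr2 : \tr (A *m A^T *m sample_cov XU) <= (1 + b) * \tr (A^T *m SigT *m A).
  rewrite -mulmxA mxtrace_mulC -mxtraceZ scalemxAl scalemxAr.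
  by apply: loewner_le_mxtrace => v; rewrite [leRHS]qformZ; exact: hU2.
have tr12 : sigma ^+ 2 / nS%:R * \tr (C *m invmx (sample_cov XS) *m C^T *m sample_cov XU)
    <= (1 + b) / (1 - a) * V.
  rewrite /V [leRHS]mulrCA ler_wpM2l ?divr_ge0 ?sqr_ge0//.
  apply: (le_trans tr1); rewrite [(1 + b) / _]mulrC -mulrA.
  by apply: ler_wpM2l tr2; rewrite invr_ge0 ltW.
have -> : r ^+ 2 * ((1 + b) * tau0) = (1 + b) * (l - V) by rewrite /tau0; field; rewrite gt_eqF.
have k1 : 1 + b <= (1 + b) / (1 - a) by rewrite ler_pdivlMr//; move: (mulr_ge0 a0 b0) a0 b0; lra.
have := ler_wpM2r lV k1; lra.
Qed.

Lemma loss_S_le (C : 'M[R]_d) (tau : R) :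
  @prog_opt R d nS r sigma (sample_cov XS) (sample_cov XU) C tau ->
  (loss_S pT sigma r XS C <= (1 + 4 * b + 6 * a)%:E *
    ereal_inf (range (loss_R nS pS pT sigma r)))%E.
Proof.
move=> [feas opt].
have K0 : 0 < 1 + 4 * b + 6 * a by move: a0 b0; lra.
rewrite -ereal_inf_pZl//; apply: le_ereal_inf_tmp => _ [_ [A _ <-] <-].
have lb := @loss_R_ge0 R d nS pS pT sigma r A sigma0 nS0 pT2.
case lE : (loss_R nS pS pT sigma r A) lb => [l| |] // lb; last first.
  by rewrite gt0_muley ?leey// lte_fin.
have [tau' feas' obj'] := obj_le_loss_R lE.
apply: (le_trans (loss_S_le_obj feas)); rewrite -EFinM lee_fin.
have := opt _ _ feas'; rewrite lee_fin in lb.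
move=> h; rewrite ler_pdivrMl//; apply: (le_trans h); apply: (le_trans obj').
rewrite mulrA ler_wpM2r// ler_pdivrMr//.
have h1 : 0 <= a * (5 - 4 * b - 6 * a) by rewrite mulr_ge0//; move: a1 b1; lra.
have h2 : 0 <= b * (1 - 2 * b) by rewrite mulr_ge0//; move: b1; lra.
have := mulr_ge0 (ltW b1') h1; lra.
Qed.

End deterministic.

Section sample_prob_product.
Context {R : realType} (d nS nU : nat) (pS pT : probability (d.-tuple R) R).

Lemma sample_probX (ES : set (nS.-tuple (d.-tuple R))) (ET : set (nU.-tuple (d.-tuple R))) :
  measurable ES -> measurable ET ->
  (sample_prob pS pT (ES `*` ET) =
    iter_int pT (fun X => (\1_ET X : R)%:E) * iter_int pS (fun X => (\1_ES X : R)%:E))%E.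
Proof.
move=> mS mT.
have mIS : measurable_fun [set: nS.-tuple (d.-tuple R)] (fun X => (\1_ES X : R)%:E).
  by apply/measurable_EFinP; exact: measurable_indic.
have mIT : measurable_fun [set: nU.-tuple (d.-tuple R)] (fun X => (\1_ET X : R)%:E).
  by apply/measurable_EFinP; exact: measurable_indic.
have S0 X : (0 <= (\1_ES X : R)%:E)%E by rewrite lee_fin indicE ler0n.
have T0 X : (0 <= (\1_ET X : R)%:E)%E by rewrite lee_fin indicE ler0n.
rewrite -iter_intZ//; last exact: iter_int_ge0.
apply: eq_iter_int => X; rewrite muleC -iter_intZ//.
by apply: eq_iter_int => Y; rewrite -EFinM !indicE in_setX -natrM mulnb.
Qed.

End sample_prob_product.

Theorem theorem7 :
  exists c0 C : nat, (0 < c0)%N /\ (0 < C)%N /\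
  forall (R : realType) (d nS nU : nat) (sigma r rho delta : R)
    (pS pT : probability (d.-tuple R) R),
    (0 < d)%N -> (0 < nS)%N -> (0 < nU)%N ->
    0 < sigma -> 0 < r -> 0 < rho -> 0 < delta < 1 ->
    has_second_moments pS -> mean_zero pS -> subgaussian pS rho ->
    second_moment pS \in unitmx ->
    has_second_moments pT -> mean_zero pT -> subgaussian pT rho ->
    c0%:R * (rho ^+ 4 * (d%:R + ln delta^-1)) <= nS%:R ->
    c0%:R * (rho ^+ 4 * (d%:R + ln delta^-1)) <= nU%:R ->
    exists E : set (nS.-tuple (d.-tuple R) * nU.-tuple (d.-tuple R)),
      measurable E /\
      ((1 - delta)%:E <= sample_prob pS pT E)%E /\
      forall XS XU, E (XS, XU) ->
        sample_cov XS \in unitmx /\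
        forall (Chat : 'M[R]_d) (tau : R),
          @prog_opt R d nS r sigma (sample_cov XS) (sample_cov XU) Chat tau ->
          (loss_S pT sigma r XS Chat <=
           (1 + C%:R * Num.sqrt (rho ^+ 4 * (d%:R + ln delta^-1) / nU%:R)
              + C%:R * Num.sqrt (rho ^+ 4 * (d%:R + ln delta^-1) / nS%:R))%:E
           * ereal_inf (range (loss_R nS pS pT sigma r)))%E.
Proof.
have [c0 c0E] : exists c0, c0 = (10 ^ 6)%N by eexists.
have [C CE] : exists C, C = (50 * 60)%N by eexists.
exists c0, C; split; first by rewrite c0E expn_gt0.
split; first by rewrite CE.
move=> R d nS nU sigma r rho delta pS pT.
have {}c0E : c0%:R = 10 ^+ 6 :> R by rewrite c0E natrX.
have {}CE : C%:R = 50 * 60 :> R by rewrite CE natrM.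
move=> d0 nS0 nU0 sigma0 r0 rho0 delta01 pS2 pS_0 sS uS pT2 pT_0 sT.
set D := rho ^+ 4 * _ => nSD nUD.
have /andP[e0 e1] := delta01.
have D0 : 0 <= D.
  by rewrite mulr_ge0 ?exprn_ge0// ?ltW// ltr_wpDr ?ltr0n// ln_ge0// invf_ge1// ltW.
have rho1 := subgaussian_param_ge pS2 pS_0 d0 rho0 sS uS.
have small (n : nat) : (0 < n)%N -> c0%:R * D <= n%:R ->
    16 * D <= n%:R /\ 0 <= 416 * Num.sqrt (D / n%:R) <= 2^-1.
  move=> n0; rewrite c0E => nD; have nR : 0 < n%:R :> R by rewrite ltr0n.
  split; first by apply: le_trans nD; rewrite ler_wpM2r//; lra.
  apply/andP; split; first by rewrite mulr_ge0 ?ler0n ?sqrtr_ge0.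
  have : Num.sqrt (D / n%:R) <= (10 ^+ 3)^-1.
    rewrite -(@ler_pXn2r _ 2)// ?nnegrE ?sqrtr_ge0 ?invr_ge0 ?exprn_ge0//.
    rewrite sqr_sqrtr ?divr_ge0//.
    by rewrite exprVn -exprM ler_pdivrMr// ler_pdivlMl// exprn_gt0.
  by lra.
have [nS16 /andP[a0 a1]] := small _ nS0 nSD.
have [nU16 /andP[b0 b1]] := small _ nU0 nUD.
have [ES mES [pES hES]] := sample_cov_concentration pS2 pS_0 d0 nS0 rho0 delta01 sS rho1 nS16.
have [ET mET [pET hET]] := sample_cov_concentration pT2 pT_0 d0 nU0 rho0 delta01 sT rho1 nU16.
exists (ES `*` ET); split; first exact: measurableX.
split.
  rewrite sample_probX//; apply: (@le_trans _ _ ((1 - delta / 2)%:E * (1 - delta / 2)%:E)%E).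
    by rewrite -EFinM lee_fin; nra.
  by apply: lee_pmul => //; rewrite lee_fin; lra.
move=> XS XU [/= /hES hS /hET hU]; split.
  exact: (sample_cov_unitmx pS2 uS a1 hS).
move=> Chat tau opt.
apply: (le_trans (loss_S_le d0 nS0 sigma0 r0 pS2 pT2 uS a0 a1 b0 b1 hS hU opt)).
rewrite lee_wpmul2r//; last first.
  rewrite lee_fin -/D.
  have sU := sqrtr_ge0 (D / nU%:R); have sS' := sqrtr_ge0 (D / nS%:R).
  by rewrite CE; lra.
apply: le_ereal_inf_tmp => _ [A _ <-]; exact: loss_R_ge0.
Qed.
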